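(* $\mathsf{EXPTIME}\subseteq \mathsf{qAM}_1(\log)$, i.e. every language in $\mathsf{EXPTIME}$ has a qAM proof system with perfect completeness whose verifier uses $O(\log n)$ space.
   Context: $\mathsf{EXPTIME}=\bigcup_{k>0}\mathsf{DTIME}(2^{O(n^k)})$. **Superoperators.** A superoperator on a finite-dimensional quantum register is a finite family $\mathcal{E}=\{E_1,\dots,E_k\}$ of square matrices with rational entries with $\sum_{i=1}^k E_i^\dagger E_i=I$. Applied to a register in state $|\psi\rangle$, it yields outcome $i$ with probability $p_i=\|E_i|\psi\rangle\|^2$, and then (if $p_i>0$) the new state is $E_i|\psi\rangle/\sqrt{p_i}$. As a special one-outcome operator, the register may also be (re)initialized to a predefined state. **qAM proof systems.** A qAM proof system is a pair $(P,V)$ (prover, verifier). $V$ is a Turing machine with a two-way read-only input tape (the input is delimited by end symbols), a two-way read/write work tape, a communication cell over a finite alphabet, and a quantum register of fixed dimension (independent of the input). States of $V$ are partitioned into reading, communication, accepting and rejecting states. In a reading state, a superoperator determined by the current state and the symbols under the tape heads is applied to the register; the outcome is automatically written on the communication cell (so it is revealed to the prover), and the next configuration is determined by the state, the scanned symbols and the outcome (deterministic transitions use the identity). In a communication state, $V$ writes on the cell a symbol determined by its state, the prover answers with a symbol, and $V$'s next state is determined by its state and the prover's symbol. A prover is an arbitrary (not necessarily computable) function giving its response from the input and the communication history so far. Acceptance (rejection) probability of $(P,V)$ on $x$ is the total probability of reaching an accepting (rejecting) state. $V$ is $s(n)$ space-bounded if it uses $O(s(n))$ work-tape cells on inputs of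 length $n$. **Class.** $L\in\mathsf{qAM}_1(\log)$ iff there are $(P,V)$ with $V$ using $O(\log n)$ space and $\epsilon<\frac12$ such that: for all $x\in L$, $(P,V)$ accepts $x$ with probability exactly $1$; for all $x\notin L$ and all provers $P^*$, $(P^*,V)$ rejects $x$ with probability greater than $1-\epsilon$. *)

(* Defs.v *)
From HB Require Import structures.
From mathcomp Require Import all_boot all_order all_algebra.
From mathcomp Require Import classical_sets reals topology normedtype sequences.

Set Implicit Arguments.
Unset Strict Implicit.
Unset Printing Implicit Defensive.

Import Order.TTheory GRing.Theory Num.Theory.
Import numFieldNormedType.Exports.

Local Open Scope ring_scope.

Definition bigO (f g : nat -> nat) : Prop :=
  exists c N : nat, forall n : nat, (N <= n)%N -> (f n <= c * g n)%N.

(* Only the order of growth of the logarithm matters, hence its floor. *)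
Definition log2n (n : nat) : nat := trunc_log 2 n.

Definition language (S : finType) := seq S -> Prop.

Inductive move := MoveLeft | Stay | MoveRight.

(* There are [(dtm_extra M).+1] two-way infinite read/write tapes.  The tape
   alphabet is the disjoint union of the blank [None], the input alphabet and
   an auxiliary alphabet.  The states [q] with [dtm_halt q = Some true]
   (resp. [Some false]) are the accepting (resp. rejecting) ones. *)
Record dtm (S : finType) := Dtm {
  dtm_state : finType;
  dtm_aux : finType;
  dtm_extra : nat;
  dtm_start : dtm_state;
  dtm_halt : dtm_state -> option bool;
  dtm_trans : dtm_state ->
    {ffun 'I_dtm_extra.+1 -> option (S + dtm_aux)} ->
    dtm_state * ('I_dtm_extra.+1 -> option (S + dtm_aux) * move)
}.

Definition move_int (m : move) (p : int) : int :=
  match m with MoveLeft => p - 1 | Stay => p | MoveRight => p + 1 end.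

Section DtmSemantics.
Variables (S : finType) (M : dtm S).

Definition dtm_symbol : Type := option (S + dtm_aux M).

Record dtm_config := DtmConfig {
  dc_state : dtm_state M;
  dc_tape : 'I_(dtm_extra M).+1 -> int -> dtm_symbol;
  dc_head : 'I_(dtm_extra M).+1 -> int
}.

(* The input occupies the cells 0, ..., n - 1 of the first tape. *)
Definition dtm_init (x : seq S) : dtm_config :=
  DtmConfig (dtm_start M)
    (fun i p => if (i == ord0) && (0 <= p)
                then omap inl (onth x `|p|%N) else None)
    (fun _ => 0).

Definition dtm_step (c : dtm_config) : dtm_config :=
  if dtm_halt (dc_state c) is Some _ then c else
  let scanned : {ffun 'I_(dtm_extra M).+1 -> option (S + dtm_aux M)} :=
    [ffun i => dc_tape c i (dc_head c i)] in
  let: (q, act) := dtm_trans (dc_state c) scanned in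
  DtmConfig q
    (fun i p => if p == dc_head c i then (act i).1 else dc_tape c i p)
    (fun i => move_int (act i).2 (dc_head c i)).

Definition dtm_decides_in (L : language S) (f : nat -> nat) : Prop :=
  forall x : seq S, exists2 t : nat, (t <= f (size x))%N &
    let q := dc_state (iter t dtm_step (dtm_init x)) in
    (dtm_halt q = Some true /\ L x) \/ (dtm_halt q = Some false /\ ~ L x).

End DtmSemantics.

Definition DTIME (S : finType) (t : nat -> nat) (L : language S) : Prop :=
  exists (M : dtm S) (f : nat -> nat), bigO f t /\ dtm_decides_in M L f.

Definition EXPTIME (S : finType) (L : language S) : Prop :=
  exists2 k : nat, (0 < k)%N &
  exists2 g : nat -> nat, bigO g (fun n => (n ^ k)%N) &
    DTIME (fun n => (2 ^ g n)%N) L.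

(* The outcomes range over the communication alphabet [C]; a family with fewer
   outcomes is padded with zero matrices, whose outcomes have probability 0.
   The entries being rational, the adjoint is the transpose. *)
Record superoperator (d : nat) (C : finType) := Superoperator {
  kraus : C -> 'M[rat]_d;
  kraus_complete : \sum_(c : C) (kraus c)^T *m kraus c = 1%:M
}.

(* [Initialize c] resets the register to the predefined state; [c] is the
   symbol standing for its only outcome. *)
Inductive register_op (d : nat) (C : finType) :=
  | Apply of superoperator d C
  | Initialize of C.

Inductive input_symbol (S : Type) := LeftEnd | Letter of S | RightEnd.
Arguments LeftEnd {S}.
Arguments RightEnd {S}.

Inductive state_kind := Reading | Communication | Accepting | Rejecting.

(* [v_op] and [v_trans] are only used in reading states, [v_send] and
   [v_receive] only in communication states. *)
Record verifier (S : finType) := Verifier {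
  v_state : finType;
  v_work : finType;
  v_comm : finType;
  v_dim : nat;
  v_start : v_state;
  v_blank : v_work;
  v_qinit : 'cV[rat]_v_dim;
  v_qinit_unit : \sum_(i < v_dim) v_qinit i 0 ^+ 2 = 1;
  v_kind : v_state -> state_kind;
  v_op : v_state -> input_symbol S -> v_work -> register_op v_dim v_comm;
  (* next state, move on the input tape, symbol written on the work tape,
     move on the work tape *)
  v_trans : v_state -> input_symbol S -> v_work -> v_comm ->
    v_state * move * v_work * move;
  v_send : v_state -> v_comm;
  v_receive : v_state -> v_comm -> v_state
}.

(* The second argument is the communication history, in chronological order:
   all the symbols written so far on the communication cell, i.e. the outcomes,
   the symbols sent by the verifier and the answers of the prover. *)
Definition prover (S : finType) (V : verifier S) : Type :=
  seq S -> seq (v_comm V) -> v_comm V.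

Definition input_at (S : Type) (x : seq S) (p : nat) : input_symbol S :=
  nth RightEnd (LeftEnd :: rcons [seq Letter a | a <- x] RightEnd) p.

Definition move_nat (m : move) (p : nat) : nat :=
  match m with MoveLeft => p.-1 | Stay => p | MoveRight => p.+1 end.

Section QamSemantics.
Variables (R : realType) (S : finType) (V : verifier S).

(* The work tape is infinite to the right only. A left move from its first
   cell leaves the head there. *)
Record config := Config {
  cf_state : v_state V;
  cf_ihead : nat;
  cf_tape : nat -> v_work V;
  cf_whead : nat;
  cf_reg : 'cV[R]_(v_dim V);
  cf_hist : seq (v_comm V)
}.

Definition predefined_state : 'cV[R]_(v_dim V) := map_mx ratr (v_qinit V).

Definition initial_config : config :=
  Config (v_start V) 0 (fun _ => v_blank V) 0 predefined_state [::].

Definition sqnorm (d : nat) (psi : 'cV[R]_d) : R :=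
  \sum_(i < d) psi i 0 ^+ 2.

Definition outcome_prob (o : register_op (v_dim V) (v_comm V))
    (psi : 'cV[R]_(v_dim V)) (c : v_comm V) : R :=
  match o with
  | Apply E => sqnorm (map_mx ratr (kraus E c) *m psi)
  | Initialize c0 => (c == c0)%:R
  end.

(* Only meaningful when [outcome_prob o psi c] is positive. *)
Definition outcome_state (o : register_op (v_dim V) (v_comm V))
    (psi : 'cV[R]_(v_dim V)) (c : v_comm V) : 'cV[R]_(v_dim V) :=
  match o with
  | Apply E =>
      (Num.sqrt (outcome_prob o psi c))^-1 *: (map_mx ratr (kraus E c) *m psi)
  | Initialize _ => predefined_state
  end.

Definition config_op (x : seq S) (k : config) :
    register_op (v_dim V) (v_comm V) :=
  v_op (cf_state k) (input_at x (cf_ihead k)) (cf_tape k (cf_whead k)).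

Definition read_prob (x : seq S) (k : config) (c : v_comm V) : R :=
  outcome_prob (config_op x k) (cf_reg k) c.

(* The input head never leaves the cells 0 (left end) to n + 1 (right end). *)
Definition read_step (x : seq S) (k : config) (c : v_comm V) : config :=
  let: (q, mi, b, mw) :=
    v_trans (cf_state k) (input_at x (cf_ihead k)) (cf_tape k (cf_whead k)) c in
  Config q
    (minn (move_nat mi (cf_ihead k)) (size x).+1)
    (fun p => if p == cf_whead k then b else cf_tape k p)
    (move_nat mw (cf_whead k))
    (outcome_state (config_op x k) (cf_reg k) c)
    (rcons (cf_hist k) c).

Definition comm_step (P : prover V) (x : seq S) (k : config) : config :=
  let h := rcons (cf_hist k) (v_send (cf_state k)) in
  let a := P x h in
  Config (v_receive (cf_state k) a)
    (cf_ihead k) (cf_tape k) (cf_whead k) (cf_reg k) (rcons h a).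

(* Probability of reaching, from [k] in at most [t] steps, an accepting state
   if [b = true], a rejecting state if [b = false]. *)
Fixpoint halt_prob (P : prover V) (x : seq S) (b : bool) (t : nat)
    (k : config) : R :=
  match v_kind (cf_state k), t with
  | Accepting, _ => b%:R
  | Rejecting, _ => (~~ b)%:R
  | _, 0%N => 0
  | Reading, t'.+1 =>
      \sum_(c : v_comm V) read_prob x k c * halt_prob P x b t' (read_step x k c)
  | Communication, t'.+1 => halt_prob P x b t' (comm_step P x k)
  end.

(* These sequences are nondecreasing and bounded by 1, hence converge. *)
Definition accept_prob (P : prover V) (x : seq S) : R :=
  limn (fun t => halt_prob P x true t initial_config).

Definition reject_prob (P : prover V) (x : seq S) : R :=
  limn (fun t => halt_prob P x false t initial_config).

Inductive reachable (P : prover V) (x : seq S) : config -> Prop :=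
  | reachable_init : reachable P x initial_config
  | reachable_read (k : config) (c : v_comm V) :
      reachable P x k -> v_kind (cf_state k) = Reading ->
      0 < read_prob x k c -> reachable P x (read_step x k c)
  | reachable_comm (k : config) :
      reachable P x k -> v_kind (cf_state k) = Communication ->
      reachable P x (comm_step P x k).

(* The work head starts on cell 0 and moves by at most one cell, so the used
   cells are 0, ..., m - 1 with m - 1 the greatest position of the head. *)
Definition space_bounded (s : nat -> nat) : Prop :=
  exists2 f : nat -> nat, bigO f s &
  forall (P : prover V) (x : seq S) (k : config),
    reachable P x k -> (cf_whead k < f (size x))%N.

End QamSemantics.

Definition qAM1 (R : realType) (S : finType) (s : nat -> nat)
    (L : language S) : Prop :=
  exists (V : verifier S) (P : prover V) (eps : R),
    [/\ space_bounded R V s,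
        eps < 1 / 2,
        forall x : seq S, L x -> accept_prob R P x = 1 &
        forall x : seq S, ~ L x ->
          forall P' : prover V, 1 - eps < reject_prob R P' x].

(* Main.v *)
Require Import Defs.
From HB Require Import structures.
From Stdlib Require Relation_Operators Lexicographic_Product.
From mathcomp Require Import all_boot all_order all_algebra reals.
From mathcomp Require Import boolp classical_sets topology normedtype sequences.
From mathcomp Require Import ring lra zify.

Set Implicit Arguments.
Unset Strict Implicit.
Unset Printing Implicit Defensive.

Import Order.TTheory GRing.Theory Num.Theory.
Import numFieldNormedType.Exports.

Local Open Scope classical_set_scope.
Local Open Scope ring_scope.

(* The verifier keeps in its register a vector of natural numbers, up to a
   scalar, one entry being 1.  Rational Kraus operators update the vector by
   integer matrices, reject with positive probability when a linear test fails,
   and restart the whole protocol otherwise.  A failed test rejects with at least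
   four times the probability of accepting later in the same run, so a prover
   that fails a test in every run is rejected with probability at least 4/5,
   however small the probability that a run is completed.

   The vector holds the tapes of the exponential-time machine as numbers in base
   [b], two stacks per tape.  Popping a digit [a] from a stack [w] requires the
   prover to send [y] with [w = b y + a].  The remaining danger is a prover that
   sends digits forever, which no test detects.  Hence the digits of such a [y]
   are separated by messages of level 2, which must decrease by exactly one, so
   that they are finitely many; the digits of the latter are separated in the
   same way by messages of level 1, which have at most one digit for each cell
   of the input tape.  So numbers up to [b ^ b ^ b ^ (n + 1)] can be sent, which
   is enough for tapes of length [2 ^ O(n ^ k)], and the work tape is not used. *)

(** * Halting probabilities *)

Section SquaredNorm.
Variable R : realType.

Lemma sqnorm_ge0 d (u : 'cV[R]_d) : 0 <= sqnorm u.
Proof. by apply: sumr_ge0 => i _; rewrite sqr_ge0. Qed.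

Lemma sqnormZ d (a : R) (u : 'cV[R]_d) : sqnorm (a *: u) = a ^+ 2 * sqnorm u.
Proof. by rewrite /sqnorm mulr_sumr; apply: eq_bigr => i _; rewrite mxE exprMn. Qed.

Lemma sqnormE d (u : 'cV[R]_d) : sqnorm u = (u^T *m u) 0 0.
Proof. by rewrite mxE; apply: eq_bigr => i _; rewrite mxE expr2. Qed.

Lemma le_sqnorm d (u : 'cV[R]_d) i : u i 0 ^+ 2 <= sqnorm u.
Proof.
by rewrite /sqnorm (bigD1 i) //= lerDl sumr_ge0 // => j _; rewrite sqr_ge0.
Qed.

Lemma sum_sqnorm_kraus d (C : finType) (E : superoperator d C) (u : 'cV[R]_d) :
  \sum_c sqnorm (map_mx ratr (kraus E c) *m u) = sqnorm u.
Proof.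
transitivity ((u^T *m map_mx ratr (\sum_c (kraus E c)^T *m kraus E c) *m u) 0 0).
  rewrite (raddf_sum (map_mx ratr)) mulmx_sumr mulmx_suml summxE.
  apply: eq_bigr => c _; rewrite sqnormE trmx_mul.
  by rewrite /= map_mxM map_trmx !mulmxA.
by rewrite kraus_complete map_mx1 mulmx1 sqnormE.
Qed.

End SquaredNorm.

Section Semantics.
Variables (R : realType) (S : finType) (V : verifier S).
Implicit Types (P : prover V) (b : bool) (t : nat) (x : seq S).
Implicit Types (k : config R V) (c : v_comm V).

Definition unit_reg k := sqnorm (cf_reg k) = 1.

Lemma outcome_prob_ge0 o psi c : 0 <= @outcome_prob R S V o psi c.
Proof. by case: o => [E|c0] /=; rewrite ?sqnorm_ge0 ?ler0n. Qed.

Lemma read_prob_ge0 x k c : 0 <= read_prob x k c.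
Proof. exact: outcome_prob_ge0. Qed.

Lemma read_prob_le0 x k c : read_prob x k c <= 0 -> read_prob x k c = 0.
Proof. by move=> p0; apply/eqP; rewrite eq_le p0 read_prob_ge0. Qed.

Lemma sum_read_prob x k : unit_reg k -> \sum_c read_prob x k c = 1.
Proof.
rewrite /read_prob => uk; case: (config_op x k) => [E|c0] /=.
  by rewrite sum_sqnorm_kraus.
by rewrite (bigD1 c0) //= eqxx big1 ?addr0 // => c /negPf->.
Qed.

Lemma sqnorm_predefined : sqnorm (@predefined_state R S V) = 1.
Proof.
rewrite -(rmorph1 (@ratr R)) -(@v_qinit_unit _ V) rmorph_sum.
by apply: eq_bigr => i _; rewrite mxE rmorphXn.
Qed.

Lemma unit_reg_initial : unit_reg (initial_config R V).
Proof. exact: sqnorm_predefined. Qed.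

Lemma unit_reg_read x k c : 0 < read_prob x k c -> unit_reg (read_step x k c).
Proof.
rewrite /unit_reg /read_prob /read_step.
case: v_trans => -[[q mi] b] mw /=; case: (config_op x k) => [E|c0] /=.
  move=> p0; rewrite sqnormZ exprVn sqr_sqrtr ?mulVf ?gt_eqF //; exact: ltW.
by move=> _; exact: sqnorm_predefined.
Qed.

Lemma halt_prob_read P x b t k : v_kind (cf_state k) = Reading ->
  halt_prob P x b t.+1 k =
  \sum_c read_prob x k c * halt_prob P x b t (read_step x k c).
Proof. by move=> /= ->. Qed.

Lemma halt_prob_comm P x b t k : v_kind (cf_state k) = Communication ->
  halt_prob P x b t.+1 k = halt_prob P x b t (comm_step P x k).
Proof. by move=> /= ->. Qed.

Lemma halt_prob_accepting P x b t k : v_kind (cf_state k) = Accepting ->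
  halt_prob P x b t k = b%:R.
Proof. by case: t => [|t] /= ->. Qed.

Lemma halt_prob_rejecting P x b t k : v_kind (cf_state k) = Rejecting ->
  halt_prob P x b t k = (~~ b)%:R.
Proof. by case: t => [|t] /= ->. Qed.

Lemma halt_prob_ge0 P x b t k : 0 <= halt_prob P x b t k.
Proof.
elim: t k => [|t IH] k /=; case: v_kind => //; rewrite ?ler0n //.
by apply: sumr_ge0 => c _; rewrite mulr_ge0 ?read_prob_ge0.
Qed.

Lemma halt_probS P x b t k : halt_prob P x b t k <= halt_prob P x b t.+1 k.
Proof.
elim: t k => [|t IH] k; case kk: (v_kind (cf_state k)).
- by rewrite {1}/halt_prob kk halt_prob_ge0.
- by rewrite {1}/halt_prob kk halt_prob_ge0.
- by rewrite /= kk.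
- by rewrite /= kk.
- rewrite !halt_prob_read //; apply: ler_sum => c _.
  by rewrite ler_wpM2l ?read_prob_ge0 // IH.
- by rewrite !(halt_prob_comm _ _ _ _ kk) IH.
- by rewrite /= kk.
- by rewrite /= kk.
Qed.

Lemma halt_prob_homo P x b k :
  {homo (fun t => halt_prob P x b t k) : t t' / (t <= t')%N >-> t <= t'}.
Proof.
apply: (homo_leq (f := fun t => halt_prob P x b t k) (r := fun u v => u <= v)).
- by move=> u; exact: lexx.
- by move=> v u w; exact: le_trans.
- by move=> t; exact: halt_probS.
Qed.

Definition some_halt_prob P x t k : R :=
  halt_prob P x true t k + halt_prob P x false t k.

Lemma some_halt_prob_read P x t k : v_kind (cf_state k) = Reading ->
  some_halt_prob P x t.+1 k =
  \sum_c read_prob x k c * some_halt_prob P x t (read_step x k c).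
Proof.
move=> kk; rewrite /some_halt_prob !halt_prob_read // -big_split /=.
by apply: eq_bigr => c _; rewrite mulrDr.
Qed.

Lemma some_halt_prob_ge0 P x t k : 0 <= some_halt_prob P x t k.
Proof. by rewrite addr_ge0 ?halt_prob_ge0. Qed.

Lemma some_halt_prob_homo P x k :
  {homo (fun t => some_halt_prob P x t k) : t t' / (t <= t')%N >-> t <= t'}.
Proof. by move=> t t' tt'; rewrite lerD ?halt_prob_homo. Qed.

Section Geometric.
Variables (P : prover V) (x : seq S) (Good : config R V -> Prop).
Hypothesis Good_unit : forall k, Good k -> unit_reg k.
Hypothesis Good_read : forall k c, Good k -> v_kind (cf_state k) = Reading ->
  0 < read_prob x k c -> Good (read_step x k c).
Hypothesis Good_comm : forall k, Good k ->
  v_kind (cf_state k) = Communication -> Good (comm_step P x k).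

(** Induction on [s] carries the bound [q], uniform over good configurations, to the leaves of the
    tree of outcomes. Writing 1 as the sum of the outcome probabilities turns the survival
    probability into an average over the next configurations. *)
Lemma non_halt_markov t q s k :
    (forall k, Good k -> 1 - some_halt_prob P x t k <= q) ->
  Good k ->
  1 - some_halt_prob P x (s + t) k <= (1 - some_halt_prob P x s k) * q.
Proof.
move=> tq; elim: s k => [|s IH] k gk; have := tq k gk;
  rewrite ?add0n ?addSn; case kk: (v_kind (cf_state k)).
- by rewrite {3}/some_halt_prob /= kk addr0 subr0 mul1r.
- by rewrite {3}/some_halt_prob /= kk addr0 subr0 mul1r.
- by rewrite /some_halt_prob; case: (t) => [|t'] /=; rewrite kk; lra.
- by rewrite /some_halt_prob; case: (t) => [|t'] /=; rewrite kk; lra.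
- move=> _; rewrite !some_halt_prob_read // -(sum_read_prob x (Good_unit gk)).
  rewrite -!sumrB mulr_suml; apply: ler_sum => c _.
  have [p0|] := ltP 0 (read_prob x k c); last first.
    by move=> /read_prob_le0->; rewrite !mul0r subrr mul0r.
  rewrite -{1 3}[read_prob x k c]mulr1 -!mulrBr -mulrA ler_pM2l //.
  by apply: IH; exact: Good_read.
- move=> _; rewrite /some_halt_prob !(halt_prob_comm _ _ _ _ kk).
  by apply: IH; exact: Good_comm.
- by rewrite /some_halt_prob; case: (t) => [|t'] /=; rewrite kk; lra.
- by rewrite /some_halt_prob; case: (t) => [|t'] /=; rewrite kk; lra.
Qed.

Lemma non_halt_geometric m e j k :
    (forall k, Good k -> e <= some_halt_prob P x m k) -> e <= 1 ->
  Good k -> 1 - some_halt_prob P x (m * j) k <= (1 - e) ^+ j.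
Proof.
move=> me e1; elim: j k => [|j IH] k gk.
  rewrite muln0 expr0; have := some_halt_prob_ge0 P x 0 k; lra.
rewrite mulnS exprS.
apply: le_trans (non_halt_markov m IH gk) _.
by rewrite ler_wpM2r ?exprn_ge0 ?subr_ge0 // lerB // me.
Qed.

Lemma halt_almost_surely m e k a :
    (forall k, Good k -> e <= some_halt_prob P x m k) -> 0 < e -> 0 < a ->
  Good k -> exists t, 1 - a < some_halt_prob P x t k.
Proof.
(* The powers of 1 - e need a nonnegative base, so a larger [e] is lowered to 1. *)
move=> me e0 a0 gk; wlog e1 : e me e0 / e <= 1 => [H|].
  have [e1|e1] := leP e 1; first exact: (H e).
  apply: (H 1) => // k' gk'; apply: le_trans (me _ gk'); exact: ltW.
have : (fun n => (1 - e) ^+ n) @ \oo --> (0 : R).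
  by apply: cvg_expr; rewrite ger0_norm; lra.
move=> /cvgrPdist_lt/(_ a a0)[j _ /(_ j (leqnn j))] /=.
rewrite sub0r normrN ger0_norm ?exprn_ge0 ?subr_ge0 // => ja.
exists (m * j)%N; have := non_halt_geometric j me e1 gk; lra.
Qed.

End Geometric.

Lemma some_halt_prob_le1 P x t k : unit_reg k -> some_halt_prob P x t k <= 1.
Proof.
elim: t k => [|t IH] k uk; case kk: (v_kind (cf_state k)).
- by rewrite /some_halt_prob /= kk addr0.
- by rewrite /some_halt_prob /= kk addr0.
- by rewrite /some_halt_prob /= kk addr0.
- by rewrite /some_halt_prob /= kk add0r.
- rewrite some_halt_prob_read // -(sum_read_prob x uk); apply: ler_sum => c _.
  have [p0|] := ltP 0 (read_prob x k c); last first.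
    by move=> /read_prob_le0->; rewrite mul0r.
  by rewrite -[leRHS]mulr1 ler_pM2l //; apply: IH; exact: unit_reg_read.
- rewrite /some_halt_prob !(halt_prob_comm _ _ _ _ kk).
  exact: (IH (comm_step P x k) uk).
- by rewrite /some_halt_prob /= kk addr0.
- by rewrite /some_halt_prob /= kk add0r.
Qed.

Lemma halt_prob_le1 P x b t k : unit_reg k -> halt_prob P x b t k <= 1.
Proof.
move=> uk; apply: le_trans (some_halt_prob_le1 P x t uk).
rewrite /some_halt_prob; case: b;
  by rewrite ?lerDl ?lerDr halt_prob_ge0.
Qed.

Lemma halt_prob_cvg P x b :
  cvgn (fun t => halt_prob P x b t (initial_config R V)).
Proof.
apply: nondecreasing_is_cvgn; first by move=> t t'; exact: halt_prob_homo.
exists 1 => _ [t _ <-]; apply: halt_prob_le1; exact: unit_reg_initial.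
Qed.

Lemma halt_prob_le_lim P x b t :
  halt_prob P x b t (initial_config R V) <=
  limn (fun t => halt_prob P x b t (initial_config R V)).
Proof.
apply: (nondecreasing_cvgn_le (u_ := fun t => halt_prob P x b t _)).
  by move=> s s'; exact: halt_prob_homo.
exact: halt_prob_cvg.
Qed.

Lemma accept_prob_eq1 P x :
    (forall a : R, 0 < a ->
      exists t, 1 - a < halt_prob P x true t (initial_config R V)) ->
  accept_prob R P x = 1.
Proof.
move=> H; apply/eqP; rewrite eq_le; apply/andP; split.
  apply: limr_le; first exact: halt_prob_cvg.
  by near=> t; apply: halt_prob_le1; exact: unit_reg_initial.
apply/ler_addgt0Pr => a a0; have [t Ht] := H a a0.
have := halt_prob_le_lim P x true t; rewrite -/(accept_prob R P x); lra.
Unshelve. all: by end_near.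
Qed.

End Semantics.

(** * Completing integer matrices to a superoperator *)

Section KrausCompletion.
Variables (d : nat) (A : bool -> 'M[rat]_d).

Definition frob (B : 'M[rat]_d) : rat := \sum_r \sum_i B r i ^+ 2.

(** For a row r of [B], Lagrange's identity writes |r|^2 |u|^2 - (r.u)^2 as the sum over i < j of
    (r_i u_j - r_j u_i)^2. Each matrix carries one of the forms r_i u_j - r_j u_i in a single row.
    Completing [B] in this way takes no square root, so the entries stay rational. *)
Definition lagrange_mx (B : 'M[rat]_d) (t : 'I_d * 'I_d * 'I_d) : 'M[rat]_d :=
  \matrix_(p, q) (if p == t.1.1
    then B t.1.1 t.1.2 * (q == t.2)%:R - B t.1.1 t.2 * (q == t.1.2)%:R else 0).

Lemma sum_mul_eq (f : 'I_d -> rat) p : \sum_j f j * (p == j)%:R = f p.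
Proof.
rewrite (bigD1 p) //= eqxx mulr1 big1 ?addr0 // => j /negPf jp.
by rewrite eq_sym jp mulr0.
Qed.

(** The sum runs over ordered pairs of columns, which counts each Lagrange form twice: hence the
    factor 2. *)
Lemma sum_lagrange_mx B :
  \sum_t (lagrange_mx B t)^T *m lagrange_mx B t =
  2%:R *: ((frob B)%:M - B^T *m B).
Proof.
apply/matrixP => p q; rewrite summxE.
rewrite (eq_bigr (fun t => (B t.1.1 t.1.2 * (p == t.2)%:R
    - B t.1.1 t.2 * (p == t.1.2)%:R) * (B t.1.1 t.1.2 * (q == t.2)%:R
    - B t.1.1 t.2 * (q == t.1.2)%:R))); last first.
  move=> t _; rewrite mxE (bigD1 t.1.1) //= !mxE eqxx big1 ?addr0 // => k /negPf kt.
  by rewrite !mxE kt mul0r.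
rewrite -(pair_big xpredT xpredT (fun ri j => (B ri.1 ri.2 * (p == j)%:R
    - B ri.1 j * (p == ri.2)%:R) * (B ri.1 ri.2 * (q == j)%:R
    - B ri.1 j * (q == ri.2)%:R))) /=.
rewrite -(pair_big xpredT xpredT (fun r i => \sum_j (B r i * (p == j)%:R
    - B r j * (p == i)%:R) * (B r i * (q == j)%:R - B r j * (q == i)%:R))) /=.
transitivity (\sum_r 2%:R * ((\sum_i B r i ^+ 2) * (p == q)%:R - B r p * B r q));
  last first.
  rewrite -mulr_sumr sumrB -mulr_suml !mxE mulr_natr.
  by congr (_ * (_ - _)); apply: eq_bigr => r _; rewrite mxE.
apply: eq_bigr => r _.
(* Expanding the product leaves four double sums, each collapsed by its Kronecker symbols; the two
   squared ones agree, and so do the two mixed ones. *)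
transitivity (\sum_i \sum_j (B r i ^+ 2 * (q == p)%:R * (p == j)%:R)
  + \sum_i \sum_j (B r j ^+ 2 * ((q == p)%:R * (p == i)%:R))
  - \sum_i \sum_j (B r i * B r j * (p == j)%:R * (q == i)%:R)
  - \sum_i \sum_j (B r i * B r j * (q == j)%:R * (p == i)%:R)).
  rewrite -big_split -!sumrB /=; apply: eq_bigr => i _.
  rewrite -big_split -!sumrB /=; apply: eq_bigr => j _.
  have e1 (k : 'I_d) : (q == p)%:R * (p == k)%:R = (p == k)%:R * (q == k)%:R :> rat.
    by case: (eqVneq p k) => [->|]; rewrite ?mulr1 ?mul1r ?mulr0 ?mul0r.
  rewrite -!mulrA !e1; ring.
have -> : \sum_i \sum_j (B r i ^+ 2 * (q == p)%:R * (p == j)%:R)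
    = (\sum_i B r i ^+ 2) * (p == q)%:R.
  rewrite mulr_suml; apply: eq_bigr => i _.
  by rewrite (sum_mul_eq (fun=> B r i ^+ 2 * (q == p)%:R)) eq_sym.
have -> : \sum_i \sum_j (B r j ^+ 2 * ((q == p)%:R * (p == i)%:R))
    = (\sum_i B r i ^+ 2) * (p == q)%:R.
  rewrite exchange_big /= mulr_suml; apply: eq_bigr => i _.
  by under eq_bigr do rewrite mulrA; rewrite sum_mul_eq eq_sym.
have -> : \sum_i \sum_j (B r i * B r j * (p == j)%:R * (q == i)%:R)
    = B r p * B r q.
  by rewrite exchange_big /=; under eq_bigr do rewrite sum_mul_eq; 
     rewrite sum_mul_eq mulrC.
have -> : \sum_i \sum_j (B r i * B r j * (q == j)%:R * (p == i)%:R)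
    = B r p * B r q.
  by rewrite exchange_big /=; under eq_bigr do rewrite sum_mul_eq; rewrite sum_mul_eq.
ring.
Qed.

Definition total_frob : rat := frob (A true) + frob (A false).

Definition kraus_scale : rat := (total_frob + 1)^-1.

Definition filler : finType := (bool + (bool + bool * ('I_d * 'I_d * 'I_d)))%type.

(** The scalars make the total a perfect square, so that the normalizing factor is rational. The
    identity matrix also gives an outcome with the same probability for every unit register, which
    guarantees restarts. *)
Definition filler_mx (w : filler) : 'M[rat]_d :=
  match w with
  | inl b => (if b then 1 else total_frob)%:M
  | inr (inl b) => A b
  | inr (inr bt) => lagrange_mx (A bt.1) bt.2
  end.

Lemma frob_ge0 B : 0 <= frob B.
Proof. by apply: sumr_ge0 => i _; apply: sumr_ge0 => j _; exact: sqr_ge0. Qed.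

Lemma total_frob_ge0 : 0 <= total_frob.
Proof. by rewrite addr_ge0 ?frob_ge0. Qed.

(* With F = |A true|^2 + |A false|^2, two copies of each matrix and its Lagrange
   terms contribute 2 F, and the scalars 1 and F contribute 1 + F^2. *)
Lemma sum_filler_mx :
  \sum_b (A b)^T *m A b + \sum_w (filler_mx w)^T *m filler_mx w =
  ((total_frob + 1) ^+ 2)%:M.
Proof.
rewrite big_sumType big_sumType /= -(pair_big xpredT xpredT
  (fun b t => (lagrange_mx (A b) t)^T *m lagrange_mx (A b) t)) /=.
under [X in _ + (_ + (_ + X))]eq_bigr do rewrite sum_lagrange_mx.
rewrite !big_bool /= !tr_scalar_mx -!scalar_mxM mul1r.
apply/matrixP => p q; rewrite !mxE.
set a := \sum_j _; set b := \sum_j _.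
by case: (p == q); rewrite ?mulr1n ?mulr0n /total_frob; ring.
Qed.

End KrausCompletion.

Section CompletedFamily.
Variables (d : nat) (ans : finType).

(* [inl true] : the computation goes on; [inl false] : the test fails;
   [inr (inl a)] : an answer of the prover; [inr (inr w)] : restart. *)
Definition symb : finType := (bool + (ans + filler d))%type.

(** Outcomes and answers of the prover share one communication alphabet; the symbols reserved for
    answers get the zero matrix. *)
Definition game_kraus (A : bool -> 'M[rat]_d) (c : symb) : 'M[rat]_d :=
  kraus_scale A *: match c with
                   | inl b => A b
                   | inr (inl _) => 0
                   | inr (inr w) => filler_mx A w
                   end.

Lemma game_kraus_complete A :
  \sum_(c : symb) (game_kraus A c)^T *m game_kraus A c = 1%:M.
Proof.
have sq s (B : 'M[rat]_d) : (s *: B)^T *m (s *: B) = s ^+ 2 *: (B^T *m B).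
  by rewrite [(s *: B)^T]linearZ /= -scalemxAl -scalemxAr scalerA expr2.
rewrite big_sumType big_sumType /= /game_kraus.
under eq_bigr do rewrite sq.
under [X in _ + (X + _)]eq_bigr do rewrite scaler0 mulmx0.
under [X in _ + (_ + X)]eq_bigr do rewrite sq.
rewrite sumr_const mul0rn add0r -!scaler_sumr -scalerDr sum_filler_mx.
rewrite scale_scalar_mx -exprMn mulVf ?expr1n //.
by have := total_frob_ge0 A; lra.
Qed.

Definition game_superop A : superoperator d symb :=
  Superoperator (game_kraus_complete A).

End CompletedFamily.

(** * Games and their verifiers *)

(** A list of pairs (coefficient, coordinate) is a linear form with natural coefficients, so an
    instruction acts on the register by fixed integer matrices. *)
Record instr (ctrl coord : Type) := Instr {
  i_upd : coord -> seq (nat * coord);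
  i_lhs : seq (nat * coord);
  i_rhs : seq (nat * coord);
  i_next : option ctrl;
  i_move : move
}.

(* A one-player game on an input word: at each move the player answers a
   symbol, loses if the linear test [i_lhs = i_rhs] fails on the vector of
   counters, and wins if moreover [i_next] is [None].  The counter [g_cst]
   always holds 1. *)
Record game (S : finType) := Game {
  g_ctrl : finType;
  g_ans : finType;
  g_coord : finType;
  g_ans0 : g_ans;
  g_cst : g_coord;
  g_start : g_ctrl;
  g_instr : g_ctrl -> g_ans -> input_symbol S -> instr g_ctrl g_coord
}.

Definition feval (T : Type) (f : seq (nat * T)) (v : T -> nat) : nat :=
  (\sum_(p <- f) p.1 * v p.2)%N.

Section GamePlay.
Variables (S : finType) (G : game S) (x : seq S).

Notation vect := (g_coord G -> nat).

(* A winning move keeps only [g_cst], hence succeeds with probability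
   proportional to the square of the scalar of the register. *)
Definition eff_upd (i : instr (g_ctrl G) (g_coord G)) (c : g_coord G) :
    seq (nat * g_coord G) :=
  if c == g_cst G then [:: (1%N, g_cst G)]
  else if i_next i is Some _ then i_upd i c else [::].

Definition gupd i (v : vect) : vect := fun c => feval (eff_upd i c) v.

Lemma gupd_cst i v : gupd i v (g_cst G) = v (g_cst G).
Proof. by rewrite /gupd /feval /eff_upd eqxx big_seq1 mul1n. Qed.

Definition passes (i : instr (g_ctrl G) (g_coord G)) (v : vect) : Prop :=
  feval (i_lhs i) v = feval (i_rhs i) v.

Definition ghead (i : instr (g_ctrl G) (g_coord G)) (h : nat) : nat :=
  minn (move_nat (i_move i) h) (size x).+1.

Definition ginstr q a h := g_instr (g := G) q a (input_at x h).

Inductive winning : seq (g_ans G) -> g_ctrl G -> nat -> vect -> Prop :=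
  | winning_last a q h v :
      passes (ginstr q a h) v -> i_next (ginstr q a h) = None ->
      winning [:: a] q h v
  | winning_move a l q q' h v :
      passes (ginstr q a h) v -> i_next (ginstr q a h) = Some q' ->
      winning l q' (ghead (ginstr q a h) h) (gupd (ginstr q a h) v) ->
      winning (a :: l) q h v.

(** Being inductive, the predicate also excludes infinite plays: whatever the prover answers, a test
    fails after finitely many moves. *)
Inductive doomed : g_ctrl G -> nat -> vect -> Prop :=
  Doomed q h v :
    (forall a, passes (ginstr q a h) v -> i_next (ginstr q a h) <> None) ->
    (forall a q', passes (ginstr q a h) v -> i_next (ginstr q a h) = Some q' ->
      doomed q' (ghead (ginstr q a h) h) (gupd (ginstr q a h) v)) ->
    doomed q h v.

Definition gvect0 : vect := fun c => (c == g_cst G).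

End GamePlay.

Section Compilation.
Variables (S : finType) (G : game S).

Let d := #|g_coord G|.

Definition form_coef (f : seq (nat * g_coord G)) (c : g_coord G) : rat :=
  \sum_(p <- f) (p.1 * (p.2 == c))%:R.

(* Of the outcomes [true] and [false] the first carries the update, the second
   the test; the latter is doubled for it to be likelier than the former. *)
Definition instr_mx (i : instr (g_ctrl G) (g_coord G)) (b : bool) : 'M[rat]_d :=
  \matrix_(r, j)
    if b then form_coef (eff_upd i (enum_val r)) (enum_val j)
    else 2%:R * (form_coef (i_lhs i) (enum_val j)
         - form_coef (i_rhs i) (enum_val j)) * (enum_val r == g_cst G)%:R.

Inductive vstate :=
  | VRestart | VAsk of g_ctrl G | VDo of g_ctrl G & g_ans G | VAccept | VReject.

Definition vstate_code (s : vstate) :=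
  match s with
  | VRestart => inl (inl true) | VAccept => inl (inl false)
  | VReject => inl (inr tt) | VAsk q => inr (inl q) | VDo q a => inr (inr (q, a))
  end.
Definition vstate_decode
    (s : (bool + unit) + (g_ctrl G + g_ctrl G * g_ans G)) : vstate :=
  match s with
  | inl (inl true) => VRestart | inl (inl false) => VAccept
  | inl (inr tt) => VReject | inr (inl q) => VAsk q | inr (inr (q, a)) => VDo q a
  end.
Lemma vstate_codeK : cancel vstate_code vstate_decode.
Proof. by case. Qed.

HB.instance Definition _ := Finite.copy vstate (can_type vstate_codeK).

Notation symb := (symb d (g_ans G)).

Definition vkind (s : vstate) : state_kind :=
  match s with
  | VAsk _ => Communication | VAccept => Accepting | VReject => Rejecting
  | _ => Reading
  end.

Definition restart_symb : symb := inr (inr (inl true)).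

Definition vop (s : vstate) (y : input_symbol S) (_ : unit) :
    register_op d symb :=
  if s is VDo q a then Apply (game_superop (g_ans G) (instr_mx (g_instr q a y)))
  else Initialize _ restart_symb.

(** Restarting takes one step per input cell to cross, each of them reinitializing the register, and
    the new run starts at the left end. *)
Definition vtrans (s : vstate) (y : input_symbol S) (_ : unit) (c : symb) :
    vstate * move * unit * move :=
  match s with
  | VDo q a =>
      let i := g_instr q a y in
      let s' := match c with
                | inl true => if i_next i is Some q' then VAsk q' else VAccept
                | inl false => VReject
                | inr _ => VRestart
                end in
      (s', i_move i, tt, Stay)
  | _ => if y is LeftEnd then (VAsk (g_start G), Stay, tt, Stay)
         else (VRestart, MoveLeft, tt, Stay)
  end.

(** A symbol that is no answer of the game is read as the default answer, so a prover gains nothing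
    by it. *)
Definition vreceive (s : vstate) (c : symb) : vstate :=
  if s is VAsk q then VDo q (if c is inr (inl a) then a else g_ans0 G)
  else VRestart.

Definition vqinit : 'cV[rat]_d := \col_i (enum_val i == g_cst G)%:R.

Lemma vqinit_unit : \sum_(i < d) vqinit i 0 ^+ 2 = 1.
Proof.
rewrite (bigD1 (enum_rank (g_cst G))) //= mxE enum_rankK eqxx expr1n.
rewrite big1 ?addr0 // => i ic; rewrite mxE.
by have /negPf-> : enum_val i != g_cst G;
  [apply: contraNneq ic => <-; rewrite enum_valK|rewrite expr0n].
Qed.

Definition game_verifier : verifier S :=
  @Verifier S vstate unit symb d VRestart tt vqinit vqinit_unit
    vkind vop vtrans (fun _ => inl false) vreceive.

End Compilation.

Lemma kraus_scale_gt0 d (A : bool -> 'M[rat]_d) : 0 < kraus_scale A.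
Proof. by rewrite invr_gt0; have := total_frob_ge0 A; lra. Qed.

Lemma kraus_scale_le1 d (A : bool -> 'M[rat]_d) : kraus_scale A <= 1.
Proof. by rewrite invf_le1; have := total_frob_ge0 A; lra. Qed.

Section VerifierAnalysis.
Variables (R : realType) (S : finType) (G : game S).

Local Notation V := (game_verifier G).
Local Notation vect := (g_coord G -> nat).
Local Notation cidx := (enum_rank (g_cst G)).
Local Notation instr := (instr (g_ctrl G) (g_coord G)).
Implicit Types (i : instr) (v : vect) (k : config R V) (x : seq S).

Definition vec v : 'cV[R]_#|g_coord G| := \col_r (v (enum_val r))%:R.

Lemma form_coef_sum f v :
  \sum_(j < #|g_coord G|) ratr (form_coef f (enum_val j)) * (v (enum_val j))%:R
  = (feval f v)%:R :> R.
Proof.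
rewrite /form_coef /feval; elim: f => [|[m c] f IH].
  by rewrite big_nil big1 // => j _; rewrite big_nil raddf0 mul0r.
rewrite big_cons natrD -IH.
under eq_bigr do rewrite big_cons raddfD /= mulrDl.
rewrite big_split /=; congr (_ + _).
rewrite (bigD1 (enum_rank c)) //= enum_rankK eqxx muln1 ratr_nat natrM.
rewrite big1 ?addr0 // => j jc; rewrite ratr_nat; case: eqP => [cj|_].
  by move: jc; rewrite cj enum_valK eqxx.
by rewrite muln0 mul0r.
Qed.

Lemma mulmx_upd i v :
  map_mx ratr (instr_mx i true) *m vec v = vec (gupd i v).
Proof.
apply/matrixP => r c; rewrite ord1 !mxE -form_coef_sum.
by apply: eq_bigr => j _; rewrite !mxE.
Qed.

Lemma mulmx_test i v :
  map_mx ratr (instr_mx i false) *m vec v =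
  \col_r (2%:R * ((feval (i_lhs i) v)%:R - (feval (i_rhs i) v)%:R)
          * (enum_val r == g_cst G)%:R).
Proof.
apply/matrixP => r c; rewrite ord1 !mxE -!form_coef_sum -sumrB mulr_sumr mulr_suml.
apply: eq_bigr => j _; rewrite !mxE !rmorphM /= rmorphB /= !ratr_nat; ring.
Qed.

(** The amplitude of [g_cst] is the quantity followed through a run: its square bounds the
    probability of accepting before the next restart. *)
Lemma mulmx_upd_cst i (psi : 'cV[R]_#|g_coord G|) :
  (map_mx ratr (instr_mx i true) *m psi) cidx 0 = psi cidx 0.
Proof.
rewrite mxE (bigD1 cidx) //= big1 => [|j jc].
  rewrite addr0 !mxE /form_coef /eff_upd !enum_rankK eqxx big_seq1 /= eqxx muln1.
  by rewrite ratr_nat mul1r.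
rewrite !mxE /form_coef /eff_upd !enum_rankK eqxx big_seq1 /=.
case: eqP => [cj|_]; first by move: jc; rewrite cj enum_valK eqxx.
by rewrite muln0 ratr_nat mul0r.
Qed.

Lemma sqnorm_upd_accept i (psi : 'cV[R]_#|g_coord G|) : i_next i = None ->
  sqnorm (map_mx ratr (instr_mx i true) *m psi) = psi cidx 0 ^+ 2.
Proof.
move=> iN; rewrite /sqnorm (bigD1 cidx) //= mulmx_upd_cst big1 ?addr0 // => r rc.
rewrite mxE big1 ?expr0n // => j _; rewrite !mxE /form_coef /eff_upd iN.
case: eqP => [e|_]; first by move: rc; rewrite -e enum_valK eqxx.
by rewrite big_nil raddf0 mul0r.
Qed.

Lemma sqnorm_vec_ge1 v : v (g_cst G) = 1%N -> 1 <= sqnorm (vec v).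
Proof.
move=> v1; apply: le_trans (le_sqnorm _ cidx).
by rewrite mxE enum_rankK v1 expr1n.
Qed.

Lemma vec_gvect0 : predefined_state R V = vec (@gvect0 S G).
Proof.
by apply/matrixP => r c; rewrite ord1 !mxE ratr_nat.
Qed.

Definition iscale i : R := ratr (kraus_scale (instr_mx i)).

Lemma iscale_gt0 i : 0 < iscale i.
Proof. by rewrite /iscale ltr0q kraus_scale_gt0. Qed.

Lemma iscale2_le1 i : iscale i ^+ 2 <= 1.
Proof.
apply: exprn_ile1; first exact/ltW/iscale_gt0.
by rewrite -(rmorph1 (@ratr R)) ler_rat kraus_scale_le1.
Qed.

Lemma sum_symb (f : symb #|g_coord G| (g_ans G) -> R) : \sum_c f c =
  f (inl true) + f (inl false)
  + (\sum_a f (inr (inl a)) + \sum_w f (inr (inr w))).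
Proof. by rewrite big_sumType big_sumType big_bool. Qed.

Definition answer (x : seq S) (P : prover V) k : g_ans G :=
  if P x (rcons (cf_hist k) (inl false)) is inr (inl a) then a else g_ans0 G.

Lemma state_comm x P k q : cf_state k = VAsk q ->
  cf_state (comm_step P x k) = VDo q (answer x P k).
Proof. by move=> kq; rewrite -[LHS]/(vreceive (cf_state k) _) kq. Qed.

Section DoStep.
Variables (x : seq S) (k : config R V) (q : g_ctrl G) (a : g_ans G).
Hypothesis kq : cf_state k = VDo q a.

Let i := ginstr x q a (cf_ihead k).

Lemma kind_do : v_kind (cf_state k) = Reading.
Proof. by rewrite kq. Qed.

Lemma config_op_do :
  config_op x k = Apply (game_superop (g_ans G) (instr_mx i)).
Proof. by rewrite /config_op kq. Qed.

Lemma read_prob_do (b : bool) : read_prob x k (inl b) =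
  iscale i ^+ 2 * sqnorm (map_mx ratr (instr_mx i b) *m cf_reg k).
Proof.
by rewrite /read_prob config_op_do /= /game_kraus map_mxZ -scalemxAl sqnormZ.
Qed.

Lemma read_prob_do_ans a' : read_prob x k (inr (inl a')) = 0.
Proof.
rewrite /read_prob config_op_do /= /game_kraus map_mxZ -scalemxAl sqnormZ.
by rewrite map_mx0 mul0mx -(scale0r 0) sqnormZ expr0n mul0r mulr0.
Qed.

Lemma read_prob_do_restart : unit_reg k ->
  read_prob x k (restart_symb G) = iscale i ^+ 2.
Proof.
move=> uk; rewrite /read_prob config_op_do /= /game_kraus map_mxZ -scalemxAl.
by rewrite sqnormZ /= map_mx1 mul1mx uk mulr1.
Qed.

Lemma state_do_next : cf_state (read_step x k (inl true)) =
  if i_next i is Some q' then VAsk q' else VAccept G.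
Proof. by rewrite /read_step kq /=. Qed.

Lemma state_do_reject : cf_state (read_step x k (inl false)) = VReject G.
Proof. by rewrite /read_step kq /=. Qed.

Lemma state_do_restart w : cf_state (read_step x k (inr w)) = VRestart G.
Proof. by rewrite /read_step kq /=. Qed.

Lemma ihead_do c : cf_ihead (read_step x k c) = ghead x i (cf_ihead k).
Proof. by rewrite /read_step kq /=. Qed.

Lemma reg_do (b : bool) : cf_reg (read_step x k (inl b)) =
  (Num.sqrt (read_prob x k (inl b)))^-1 *:
    (iscale i *: (map_mx ratr (instr_mx i b) *m cf_reg k)).
Proof.
rewrite /read_prob config_op_do /read_step config_op_do kq /=.
by rewrite /game_kraus map_mxZ -scalemxAl.
Qed.

Lemma hist_do c : cf_hist (read_step x k c) = rcons (cf_hist k) c.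
Proof. by rewrite /read_step kq /=. Qed.

Lemma halt_prob_do P b t : halt_prob P x b t.+1 k =
  read_prob x k (inl true) * halt_prob P x b t (read_step x k (inl true))
  + read_prob x k (inl false) * (~~ b)%:R
  + \sum_w read_prob x k (inr (inr w))
           * halt_prob P x b t (read_step x k (inr (inr w))).
Proof.
rewrite halt_prob_read ?kind_do //.
rewrite (sum_symb (fun c => read_prob x k c * halt_prob P x b t (read_step x k c))).
rewrite [X in _ + (X + _)]big1 => [|a' _]; last by rewrite read_prob_do_ans mul0r.
rewrite add0r; congr (_ + _ * _ + _).
have := state_do_reject; case: (read_step x k (inl false)) => s h tp wh rg hs /= ->.
by case: t.
Qed.

End DoStep.

Section RestartStep.
Variables (x : seq S) (k : config R V).
Hypothesis kq : cf_state k = VRestart G.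

Lemma read_prob_restart c : read_prob x k c = (c == restart_symb G)%:R.
Proof. by rewrite /read_prob /config_op kq. Qed.

Lemma halt_prob_restart P b t : halt_prob P x b t.+1 k =
  halt_prob P x b t (read_step x k (restart_symb G)).
Proof.
rewrite halt_prob_read ?kq // (bigD1 (restart_symb G)) //=.
rewrite read_prob_restart eqxx mul1r big1 ?addr0 // => c /negPf cr.
by rewrite read_prob_restart cr mul0r.
Qed.

Lemma reg_restart c : cf_reg (read_step x k c) = vec (@gvect0 S G).
Proof.
by rewrite /read_step /config_op kq /=; case: input_at => //=;
  rewrite -vec_gvect0.
Qed.

Lemma hist_restart c : cf_hist (read_step x k c) = rcons (cf_hist k) c.
Proof. by rewrite /read_step kq /=; case: input_at. Qed.

Lemma restart_cases c :
  (cf_ihead k = 0%N /\ cf_ihead (read_step x k c) = 0%N /\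
    cf_state (read_step x k c) = VAsk (g_start G)) \/
  ((0 < cf_ihead k)%N /\
    cf_ihead (read_step x k c) = minn (cf_ihead k).-1 (size x).+1 /\
    cf_state (read_step x k c) = VRestart G).
Proof.
rewrite /read_step kq /=; case: (cf_ihead k) => [|h] /=; first by left.
right; have : input_at x h.+1 <> LeftEnd.
  rewrite /input_at /=; elim: x h => [|y x' IH] [|h] //=.
  by rewrite nth_nil.
by case: input_at.
Qed.

End RestartStep.

End VerifierAnalysis.

(** * Soundness *)

Section GameSoundness.
Variables (R : realType) (S : finType) (G : game S) (x : seq S).

Local Notation V := (game_verifier G).
Local Notation vect := (g_coord G -> nat).
Local Notation cidx := (enum_rank (g_cst G)).
Implicit Types (v : vect) (k : config R V) (P : prover V).

(* The register is only determined by [v] up to a scalar. *)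
Definition holds k v : Prop :=
  v (g_cst G) = 1%N /\ exists s : R, cf_reg k = s *: vec R v.

Definition doomed_move q a h v : Prop :=
  (passes (ginstr x q a h) v -> i_next (ginstr x q a h) <> None) /\
  (forall q', passes (ginstr x q a h) v -> i_next (ginstr x q a h) = Some q' ->
    doomed x q' (ghead x (ginstr x q a h) h) (gupd (ginstr x q a h) v)).

Lemma doomed_moves q h v : doomed x q h v -> forall a, doomed_move q a h v.
Proof. by case=> {}q {}h {}v H1 H2 a; split; [exact: H1|exact: H2]. Qed.

(* The positions from which every run fails a test before accepting. *)
Definition bad k : Prop :=
  match cf_state k with
  | VAsk q => exists2 v, holds k v & doomed x q (cf_ihead k) v
  | VDo q a => exists2 v, holds k v & doomed_move q a (cf_ihead k) v
  | VAccept => False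
  | _ => True
  end.

Lemma holds_next k q a v (i := ginstr x q a (cf_ihead k)) :
  cf_state k = VDo q a -> holds k v ->
  holds (read_step x k (inl true)) (gupd i v).
Proof.
move=> kq [v1 [s ks]]; split; first by rewrite gupd_cst.
rewrite (reg_do x kq) ks -scalemxAr mulmx_upd !scalerA.
by eexists.
Qed.

Lemma holds_restart k c : cf_state k = VRestart G ->
  holds (read_step x k c) (@gvect0 S G).
Proof.
move=> kq; split; first by rewrite /gvect0 eqxx.
by exists 1; rewrite (reg_restart x kq) scale1r.
Qed.

(** The renormalization of the new state cancels against the probability of the outcome, so the
    squared amplitude of [g_cst], weighted by that probability, cannot grow. *)
Lemma read_prob_upd k q a (i := ginstr x q a (cf_ihead k)) :
  cf_state k = VDo q a -> 0 < read_prob x k (inl true) ->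
  read_prob x k (inl true) * cf_reg (read_step x k (inl true)) cidx 0 ^+ 2 =
  iscale R i ^+ 2 * cf_reg k cidx 0 ^+ 2.
Proof.
move=> kq p0; rewrite (reg_do x kq) mxE mxE mulmx_upd_cst !exprMn exprVn.
by rewrite sqr_sqrtr ?(ltW p0) // mulVKf ?gt_eqF.
Qed.

Lemma read_prob_upd_accept k q a (i := ginstr x q a (cf_ihead k)) :
  cf_state k = VDo q a -> i_next i = None ->
  read_prob x k (inl true) = iscale R i ^+ 2 * cf_reg k cidx 0 ^+ 2.
Proof. by move=> kq iN; rewrite (read_prob_do x kq) sqnorm_upd_accept. Qed.

(** The two sides of a failed test are distinct natural numbers, so their difference has square at
    least 1, and the doubling in [instr_mx] contributes the factor 4. *)
Lemma read_prob_test k q a v (i := ginstr x q a (cf_ihead k)) :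
  cf_state k = VDo q a -> holds k v -> ~ passes i v ->
  4%:R * (iscale R i ^+ 2 * cf_reg k cidx 0 ^+ 2) <= read_prob x k (inl false).
Proof.
move=> kq [v1 [s ks]] nt; rewrite (read_prob_do x kq) mulrCA.
rewrite ler_wpM2l ?sqr_ge0 // ks -scalemxAr mulmx_test sqnormZ.
rewrite !mxE enum_rankK v1 mulr1 mulrC ler_wpM2l ?sqr_ge0 //.
apply: le_trans (le_sqnorm _ cidx); rewrite mxE enum_rankK eqxx mulr1 exprMn.
rewrite -natrX ler_peMr //.
have : feval (i_lhs i) v <> feval (i_rhs i) v by [].
move: (feval _ _) (feval _ _) => n m mn.
have [mn'|nm] := leqP m n.
  rewrite -sqrrN opprB -natrB // -natrX ler1n expn_gt0 subn_gt0.
  by rewrite ltn_neqAle mn' andbT; case: eqP.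
by rewrite -natrB 1?ltnW // -natrX ler1n expn_gt0 subn_gt0 nm.
Qed.

Lemma read_prob_pass k q a v (i := ginstr x q a (cf_ihead k)) :
  cf_state k = VDo q a -> holds k v -> passes i v ->
  read_prob x k (inl false) = 0.
Proof.
move=> kq [v1 [s ks]] t; rewrite (read_prob_do x kq) ks -scalemxAr sqnormZ.
rewrite mulmx_test t subrr mulr0 /sqnorm big1 ?mulr0 // => r _.
by rewrite mxE mul0r expr0n.
Qed.

(** Acceptance comes either in the current run or after a restart. The second bound charges the
    former to the squared amplitude of [g_cst] and the latter to a quarter of the rejection
    probability. The induction needs it for the moves that fail their test, in order to obtain the
    first bound. *)
Definition ratio_bound P t k : Prop :=
  (bad k -> halt_prob P x true t k <= halt_prob P x false t k / 4%:R) /\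
  (cf_state k <> VAccept G -> halt_prob P x true t k <=
     cf_reg k cidx 0 ^+ 2 + halt_prob P x false t k / 4%:R).

Lemma ratio_bound0 P k : unit_reg k -> ratio_bound P 0 k.
Proof.
move=> uk; rewrite /ratio_bound.
have r0 := halt_prob_ge0 P x false 0 k; have s0 := sqr_ge0 (cf_reg k cidx 0).
rewrite /= /bad; case: (cf_state k) r0 => [|q|q a||] /= r0; split=> //;
  try by move=> _; lra.
Qed.

Section RatioStep.
Variables (P : prover V) (t : nat).
Hypothesis IH : forall k, unit_reg k -> ratio_bound P t k.
Hypothesis x_doomed : doomed x (g_start G) 0 (@gvect0 S G).

Lemma ratio_bound_restart k :
  cf_state k = VRestart G -> unit_reg k -> ratio_bound P t.+1 k.
Proof.
move=> kq uk; have s0 := sqr_ge0 (cf_reg k cidx 0); rewrite /ratio_bound.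
have H : halt_prob P x true t.+1 k <= halt_prob P x false t.+1 k / 4%:R.
  rewrite !(halt_prob_restart x kq).
  have p0 : 0 < read_prob x k (restart_symb G).
    by rewrite (read_prob_restart x kq) eqxx.
  have [H _] := IH (unit_reg_read p0); apply: H; rewrite /bad.
  case: (restart_cases x kq (restart_symb G)) => [[k0 [k1 ->]]|[_ [_ ->]]] //.
  by exists (@gvect0 S G); [exact: holds_restart|rewrite k1].
by split=> // _; lra.
Qed.

Lemma ratio_bound_ask k q :
  cf_state k = VAsk q -> unit_reg k -> ratio_bound P t.+1 k.
Proof.
move=> kq uk; rewrite /ratio_bound.
have kc : v_kind (cf_state k) = Communication by rewrite kq.
rewrite !(halt_prob_comm _ _ _ _ kc).
have [H1 H2] := @IH (comm_step P x k) uk; split.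
  rewrite /bad kq => -[v kv dv]; apply: H1.
  rewrite /bad (state_comm x P kq); exists v; [exact: kv|exact: doomed_moves].
by move=> _; apply: H2; rewrite (state_comm x P kq).
Qed.

Lemma ratio_bound_do k q a :
  cf_state k = VDo q a -> unit_reg k -> ratio_bound P t.+1 k.
Proof.
move=> kq uk; have s0 := sqr_ge0 (cf_reg k cidx 0); rewrite /ratio_bound.
pose i := ginstr x q a (cf_ihead k).
(* [T], [F] and [W] are the contributions of going on, of failing the test and of restarting. *)
pose T b := read_prob x k (inl true)
  * halt_prob P x b t (read_step x k (inl true)).
pose F := read_prob x k (inl false).
pose W b := \sum_w read_prob x k (inr (inr w))
  * halt_prob P x b t (read_step x k (inr (inr w))).
rewrite !(halt_prob_do x kq) /= mulr0 mulr1 addr0 -/(T _) -/(T _) -/F -/(W _) -/(W _).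
have F0 : 0 <= F by exact: read_prob_ge0.
have TF : 0 <= T false by rewrite mulr_ge0 ?read_prob_ge0 ?halt_prob_ge0.
have WW : W true <= W false / 4%:R.
  rewrite mulr_suml; apply: ler_sum => w _; rewrite -mulrA.
  have [p0|p0] := ltP 0 (read_prob x k (inr (inr w))).
    rewrite ler_pM2l //; apply: (IH (unit_reg_read p0)).1.
    by rewrite /bad (state_do_restart x kq).
  by rewrite (read_prob_le0 p0) !mul0r.
pose s := iscale R i ^+ 2 * cf_reg k cidx 0 ^+ 2.
have s_ge0 : 0 <= s by rewrite mulr_ge0 ?sqr_ge0.
have sle : s <= cf_reg k cidx 0 ^+ 2 by rewrite ler_piMl // iscale2_le1.
have TT : T true <= s + T false / 4%:R.
  have [p0|p0] := ltP 0 (read_prob x k (inl true)); last first.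
    by rewrite /T (read_prob_le0 p0) !mul0r addr0.
  case iN: (i_next i) => [q'|].
    have := (IH (unit_reg_read p0)).2; rewrite (state_do_next x kq) -/i iN => /(_ _).
    rewrite -(ler_pM2l p0) mulrDr (read_prob_upd kq p0) -/i -/s /T -mulrA.
    by apply.
  rewrite /s -(read_prob_upd_accept kq iN).
  apply: (@le_trans _ _ (read_prob x k (inl true))); last first.
    by rewrite lerDl divr_ge0.
  by rewrite ler_piMr ?(ltW p0) // halt_prob_le1 //; exact: unit_reg_read.
split=> [|_]; last by lra.
rewrite /bad kq => -[v kv [D1 D2]].
(* If the test fails, [F] is at least 4 s, which pays for the term s in [TT]; if it passes, the next
   configuration is bad again. *)
have [ps|nps] := pselect (passes i v); last first.
  have := read_prob_test kq kv nps; rewrite -/i -/s -/F; lra.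
suff : T true <= T false / 4%:R by lra.
case iN: (i_next i) => [q'|]; last by case: (D1 ps iN).
have [p0|p0] := ltP 0 (read_prob x k (inl true)); last first.
  by rewrite /T (read_prob_le0 p0) !mul0r.
rewrite /T -mulrA ler_pM2l //; apply: (IH (unit_reg_read p0)).1.
rewrite /bad (state_do_next x kq) -/i iN; exists (gupd i v); first exact: holds_next.
by rewrite (ihead_do x kq); exact: D2.
Qed.

End RatioStep.

Lemma accept_le_reject P t k : doomed x (g_start G) 0 (@gvect0 S G) ->
  unit_reg k -> ratio_bound P t k.
Proof.
move=> x_doomed; elim: t k => [|t IH] k uk; first exact: ratio_bound0.
case kq: (cf_state k) => [|q|q a||].
- exact: ratio_bound_restart.
- exact: ratio_bound_ask kq uk.
- exact: ratio_bound_do kq uk.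
- by split; [rewrite /bad kq|case].
- have kr : v_kind (cf_state k) = Rejecting by rewrite kq.
  rewrite /ratio_bound !(halt_prob_rejecting _ _ _ _ kr) /=.
  by have := sqr_ge0 (cf_reg k cidx 0); split=> _; lra.
Qed.

End GameSoundness.

(** * Almost sure halting of the verifier *)

Section Halting.
Variables (R : realType) (S : finType) (G : game S) (x : seq S).

Local Notation V := (game_verifier G).
Local Notation vect := (g_coord G -> nat).
Implicit Types (v : vect) (k : config R V) (P : prover V).

Definition good k : Prop := unit_reg k /\ (cf_ihead k <= (size x).+1)%N.

Lemma good_unit k : good k -> unit_reg k.
Proof. by case. Qed.

Lemma good_read k c : good k -> v_kind (cf_state k) = Reading ->
  0 < read_prob x k c -> good (read_step x k c).
Proof.
move=> _ _ p0; split; first exact: unit_reg_read.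
by rewrite /read_step; case: v_trans => -[[q m] b] w /=; exact: geq_minr.
Qed.

Lemma good_comm P k : good k -> v_kind (cf_state k) = Communication ->
  good (comm_step P x k).
Proof. by []. Qed.

Lemma good_initial : good (initial_config R V).
Proof. by split; first exact: unit_reg_initial. Qed.

(** On a fixed input only finitely many instructions occur, and the sum [M] of their Frobenius
    totals bounds all the scales from below at once. *)
Lemma iscale2_bound : exists2 e : R, 0 < e <= 1 &
  forall (q : g_ctrl G) a h, (h <= (size x).+1)%N -> e <= iscale R (ginstr x q a h) ^+ 2.
Proof.
pose F (q : g_ctrl G) a h := total_frob (instr_mx (ginstr x q a h)).
pose M := \sum_(t : g_ctrl G * g_ans G * 'I_(size x).+2) F t.1.1 t.1.2 t.2.
have F0 q a h : 0 <= F q a h by exact: total_frob_ge0.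
have M0 : 0 <= M by apply: sumr_ge0.
exists (ratr (M + 1)^-1 ^+ 2).
  have H : 0 < ratr (M + 1)^-1 :> R by rewrite ltr0q invr_gt0; lra.
  rewrite exprn_gt0 //= exprn_ile1 ?(ltW H) //.
  by rewrite -(rmorph1 (@ratr R)) ler_rat invf_le1; lra.
move=> q a h hx; apply: lerXn2r; rewrite ?nnegrE.
- by rewrite ler0q invr_ge0; lra.
- exact/ltW/iscale_gt0.
have Fh := F0 q a h; rewrite ler_rat lef_pV2 ?posrE -/(F q a h); try lra.
rewrite lerD2r.
have hx' : (h < (size x).+2)%N by [].
rewrite /M (bigD1 (q, a, Ordinal hx')) //= lerDl; exact: sumr_ge0.
Qed.

Variables (P : prover V) (d : R) (N : nat).
Hypothesis d0 : 0 < d.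
Hypothesis from_start : forall k hs, cf_state k = VAsk (g_start G) ->
  cf_ihead k = 0%N -> holds k (@gvect0 S G) -> unit_reg k ->
  cf_hist k = rcons hs (restart_symb G) -> d <= some_halt_prob P x N k.

Lemma halt_from_restart m k : cf_state k = VRestart G -> unit_reg k ->
  (cf_ihead k <= m)%N -> d <= some_halt_prob P x (m.+1 + N) k.
Proof.
elim: m k => [|m IH] k kq uk hm; rewrite addSn /some_halt_prob
    !(halt_prob_restart x kq) -/(some_halt_prob _ _ _ _);
  have p0 : 0 < read_prob x k (restart_symb G) by
    [rewrite (read_prob_restart x kq) eqxx];
  have u' := unit_reg_read p0;
  case: (restart_cases x kq (restart_symb G)) => [[k0 [k1 k2]]|[k0 [k1 k2]]].
- by apply: from_start k2 k1 (holds_restart _ _ kq) u' (hist_restart _ kq _).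
- by move: hm; rewrite leqNgt k0.
- apply: le_trans
    (from_start k2 k1 (holds_restart _ _ kq) u' (hist_restart _ kq _)) _.
  by apply: some_halt_prob_homo; rewrite leq_addl.
- apply: IH => //.
  by rewrite k1; apply: leq_trans (geq_minl _ _) _; rewrite -ltnS prednK.
Qed.

Let M := ((size x).+2 + N)%N.

(** Any running configuration is restarting within two steps with probability at least [e]; then the
    head is rewound and the bound [d] for the start of a run applies. *)
Lemma halt_lower_bound :
  exists2 e : R, 0 < e & forall k, good k -> e <= some_halt_prob P x M.+2 k.
Proof.
have [e /andP[e0 e1] He] := iscale2_bound.
(* The minimum with 1 makes [u] a lower bound for the halted configurations too, whose probability
   is 1. *)
pose u := e * Num.min d 1; exists u; first by rewrite mulr_gt0 // lt_min d0 ltr01.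
have m0 : 0 <= Num.min d 1 by rewrite le_min ltW //=.
have um : u <= Num.min d 1 by rewrite ler_piMl.
have [ud u1] : u <= d /\ u <= 1 by move: um; rewrite le_min => /andP[].
have Hr k : cf_state k = VRestart G -> good k -> d <= some_halt_prob P x M k.
  by move=> kq [uk hk]; apply: halt_from_restart.
have Hd k q a : cf_state k = VDo q a -> good k -> u <= some_halt_prob P x M.+1 k.
  move=> kq gk; have kr := kind_do kq; rewrite some_halt_prob_read //.
  rewrite (bigD1 (restart_symb G)) //=.
  have pE := read_prob_do_restart x kq gk.1.
  have p0 : 0 < read_prob x k (restart_symb G).
    by rewrite pE exprn_gt0 // iscale_gt0.
  apply: (@le_trans _ _ (e * d)).
    by rewrite /u ler_pM2l // ge_min lexx.
  apply: (@le_trans _ _ (read_prob x k (restart_symb G)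
      * some_halt_prob P x M (read_step x k (restart_symb G)))).
    apply: ler_pM; rewrite ?(ltW e0) ?(ltW d0) //.
      by rewrite pE He // gk.2.
    apply: Hr; first by rewrite (state_do_restart x kq).
    exact: good_read.
  rewrite lerDl; apply: sumr_ge0 => c _.
  by rewrite mulr_ge0 ?read_prob_ge0 ?some_halt_prob_ge0.
move=> k gk; case kq: (cf_state k) => [|q|q a||].
- apply: le_trans ud _; apply: le_trans (Hr _ kq gk) _.
  by apply: some_halt_prob_homo; rewrite -addn2 leq_addr.
- have kc : v_kind (cf_state k) = Communication by rewrite kq.
  rewrite /some_halt_prob !(halt_prob_comm _ _ _ _ kc) -/(some_halt_prob _ _ _ _).
  by apply: (Hd _ _ _ (state_comm x P kq)); exact: good_comm.
- apply: le_trans (Hd _ _ _ kq gk) _; exact: some_halt_prob_homo.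
- have ka : v_kind (cf_state k) = Accepting by rewrite kq.
  by rewrite /some_halt_prob !(halt_prob_accepting _ _ _ _ ka) addr0.
- have ka : v_kind (cf_state k) = Rejecting by rewrite kq.
  by rewrite /some_halt_prob !(halt_prob_rejecting _ _ _ _ ka) add0r.
Qed.

Lemma game_halts a : 0 < a ->
  exists t, 1 - a < some_halt_prob P x t (initial_config R V).
Proof.
move=> a0; have [e e0 He] := halt_lower_bound.
apply: (halt_almost_surely good_unit good_read _ He e0 a0 good_initial).
exact: good_comm.
Qed.

End Halting.

(** The prover has finitely many answers, so the largest number of steps and the least probability
    serve all of them. *)
Lemma finite_witness_bound (R : realType) (I : finType)
    (Q : I -> nat -> R -> Prop) :
  (forall i n e n' e', Q i n e -> (n <= n')%N -> e' <= e -> Q i n' e') ->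
  (forall i, exists n, exists2 e, 0 < e & Q i n e) ->
  exists n, exists2 e, 0 < e & forall i, Q i n e.
Proof.
move=> mon /choice[n nP].
have /choice[e He] i : exists e, 0 < e /\ Q i (n i) e.
  by have [e e0 Qe] := nP i; exists e.
exists (\max_i n i)%N.
exists (\big[Num.min/1]_i e i).
  elim/big_ind: _ => // [a b a0 b0|i _]; first by rewrite lt_min a0.
  by case: (He i).
move=> i; apply: mon (He i).2 _ _; first exact: leq_bigmax.
exact: bigmin_le.
Qed.

Section DoomedIsRejected.
Variables (R : realType) (S : finType) (G : game S) (x : seq S).

Local Notation V := (game_verifier G).
Local Notation vect := (g_coord G -> nat).
Implicit Types (v : vect) (k : config R V) (P : prover V).

Lemma holds_scale k v (s : R) : v (g_cst G) = 1%N -> cf_reg k = s *: vec R v ->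
  unit_reg k -> s ^+ 2 = (sqnorm (vec R v))^-1.
Proof.
move=> v1 ks; rewrite /unit_reg ks sqnormZ => uk.
have vn0 : sqnorm (vec R v) != 0.
  by rewrite gt_eqF // (lt_le_trans ltr01) // sqnorm_vec_ge1.
by rewrite -[LHS](mulfK vn0) uk mul1r.
Qed.

Lemma read_prob_upd_ge k q a v (i := ginstr x q a (cf_ihead k)) :
  cf_state k = VDo q a -> holds k v -> unit_reg k ->
  iscale R i ^+ 2 / sqnorm (vec R v) <= read_prob x k (inl true).
Proof.
move=> kq [v1 [s ks]] uk; rewrite (read_prob_do x kq) ks -scalemxAr mulmx_upd.
rewrite sqnormZ ler_pM2l ?exprn_gt0 ?iscale_gt0 //.
rewrite -(holds_scale v1 ks uk) ler_peMr ?sqr_ge0 //; apply: sqnorm_vec_ge1.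
by rewrite gupd_cst.
Qed.

Lemma read_prob_test_ge k q a v (i := ginstr x q a (cf_ihead k)) :
  cf_state k = VDo q a -> holds k v -> unit_reg k -> ~ passes i v ->
  iscale R i ^+ 2 / sqnorm (vec R v) <= read_prob x k (inl false).
Proof.
move=> kq kv uk np; apply: le_trans (read_prob_test kq kv np).
have [v1 [s ks]] := kv; rewrite mulrCA ler_pM2l ?exprn_gt0 ?iscale_gt0 //.
have vn : 1 <= sqnorm (vec R v) by exact: sqnorm_vec_ge1.
rewrite ks !mxE enum_rankK v1 mulr1 (holds_scale v1 ks uk) ler_peMl ?invr_ge0 //; lra.
Qed.

(** Induction on [doomed]. A move goes on if its test passes, and rejects if it fails, with
    probability at least [s]. This bound depends only on the move and on [v], neither on the prover
    nor on the configuration, and the bounds multiply along the play. *)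
Lemma doomed_rejected q h v : doomed x q h v -> v (g_cst G) = 1%N ->
  exists N, exists2 e : R, 0 < e & forall P k, cf_state k = VAsk q ->
    cf_ihead k = h -> holds k v -> unit_reg k ->
    e <= halt_prob P x false N k.
Proof.
elim=> {}q {}h {}v H1 _ H2 v1.
pose Q (a : g_ans G) n (e : R) := forall P k, cf_state k = VDo q a ->
  cf_ihead k = h -> holds k v -> unit_reg k -> e <= halt_prob P x false n k.
have [|a|n [e e0 He]] := @finite_witness_bound R _ Q.
- move=> a n e n' e' H nn' ee' P k kq kh kv uk; apply: le_trans ee' _.
  by apply: le_trans (H P k kq kh kv uk) _; exact: halt_prob_homo.
- set i := ginstr x q a h.
  pose s := iscale R i ^+ 2 / sqnorm (vec R v).
  have s0 : 0 < s.
    rewrite divr_gt0 ?exprn_gt0 ?iscale_gt0 //.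
    by have := @sqnorm_vec_ge1 R S G v v1; lra.
  have [ps|nps] := pselect (passes i v); last first.
    exists 1%N, s => // P k kq kh kv uk; rewrite (halt_prob_do x kq) mulr1.
    have := @read_prob_test_ge k q a v kq kv uk; rewrite kh => /(_ nps).
    rewrite -/i -/s => sp; apply: (le_trans sp); rewrite -addrA addrCA lerDl.
    rewrite addr_ge0 ?mulr_ge0 ?read_prob_ge0 ?halt_prob_ge0 //.
    by apply: sumr_ge0 => w _; rewrite ?mulr_ge0 ?read_prob_ge0 ?halt_prob_ge0.
  case iN: (i_next i) => [q'|]; last by case: (H1 a ps iN).
  have [|n [e e0 He]] := H2 a q' ps iN; first by rewrite gupd_cst.
  exists n.+1, (s * e); first by rewrite mulr_gt0.
  move=> P k kq kh kv uk; rewrite (halt_prob_do x kq).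
  have sp := @read_prob_upd_ge k q a v kq kv uk; rewrite kh -/i -/s in sp.
  have p0 : 0 < read_prob x k (inl true) by exact: lt_le_trans sp.
  apply: (@le_trans _ _ (read_prob x k (inl true)
    * halt_prob P x false n (read_step x k (inl true)))).
    apply: ler_pM; rewrite ?(ltW s0) ?(ltW e0) //; apply: He.
    + by rewrite (state_do_next x kq) kh -/i iN.
    + by rewrite (ihead_do x kq) kh.
    + by have := holds_next x kq kv; rewrite kh.
    + exact: unit_reg_read.
  rewrite -addrA lerDl addr_ge0 ?mulr_ge0 ?read_prob_ge0 //.
  by apply: sumr_ge0 => w _; rewrite ?mulr_ge0 ?read_prob_ge0 ?halt_prob_ge0.
- exists n.+1, e => // P k kq kh kv uk.
  have kc : v_kind (cf_state k) = Communication by rewrite kq.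
  rewrite (halt_prob_comm _ _ _ _ kc); apply: (He (answer x P k)) => //.
  exact: (state_comm x P kq).
Qed.

End DoomedIsRejected.

(** * Completeness *)

Section HonestProver.
Variables (R : realType) (S : finType) (G : game S) (cert : seq S -> seq (g_ans G)).

Local Notation V := (game_verifier G).
Local Notation vect := (g_coord G -> nat).
Local Notation symb := (symb #|g_coord G| (g_ans G)).
Implicit Types (v : vect) (k : config R V) (x : seq S).

(** The honest prover reads its position in the certificate off the history. A successful move
    leaves [inl true] there and a restart some [inr (inr _)]; the question [inl false] of the
    verifier and the answers count for nothing. *)
Definition count_symb (n : nat) (c : symb) : nat :=
  match c with inl true => n.+1 | inr (inr _) => 0%N | _ => n end.

Definition moves_played (hs : seq symb) : nat := foldl count_symb 0%N hs.

Definition honest : prover V := fun x hs =>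
  inr (inl (nth (g_ans0 G) (cert x) (moves_played hs))).

Definition cert_left x k : seq (g_ans G) := drop (moves_played (cf_hist k)) (cert x).

Lemma answer_honest x k a l : cert_left x k = a :: l -> answer x honest k = a.
Proof.
rewrite /cert_left /answer /honest /moves_played foldl_rcons /=.
by move: (foldl _ _ _) => m /(congr1 (nth (g_ans0 G) ^~ 0%N)); rewrite nth_drop addn0.
Qed.

Lemma cert_left_comm x k :
  cert_left x (comm_step honest x k) = cert_left x k.
Proof. by rewrite /cert_left /= /moves_played !foldl_rcons /=. Qed.

Lemma cert_left_do x k q a b l : cf_state k = VDo q a -> cert_left x k = b :: l ->
  cert_left x (read_step x k (inl true)) = l.
Proof.
move=> kq; rewrite /cert_left (hist_do x kq) /moves_played foldl_rcons /=.
by move: (foldl _ _ _) => m E; rewrite -add1n -drop_drop E /= drop0.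
Qed.

Lemma cert_left_restart x k : cf_state k = VRestart G ->
  cert_left x (read_step x k (restart_symb G)) = cert x.
Proof.
by move=> kq; rewrite /cert_left (hist_restart x kq) /moves_played foldl_rcons drop0.
Qed.

Section Word.
Variable x : seq S.

Lemma winning_inv a l q h v : winning x (a :: l) q h v ->
  passes (ginstr x q a h) v /\
  (forall q', i_next (ginstr x q a h) = Some q' ->
    winning x l q' (ghead x (ginstr x q a h) h) (gupd (ginstr x q a h) v)).
Proof.
move E: (a :: l) => r w; case: w E => [b {}q {}h {}v ps iN|b r' {}q q' {}h {}v ps iN w].
  by case=> -> _; split=> // q'; rewrite iN.
by case=> -> ->; split=> // q''; rewrite iN => -[<-].
Qed.

(** All the moves of a winning play pass their tests, and each goes on with probability at least
    [s]; the product of these bounds does not depend on the configuration. *)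
Lemma winning_accepted l q h v : winning x l q h v -> v (g_cst G) = 1%N ->
  exists N, exists2 e : R, 0 < e & forall k, cf_state k = VAsk q ->
    cf_ihead k = h -> holds k v -> unit_reg k -> cert_left x k = l ->
    e <= halt_prob honest x true N k.
Proof.
have ask n e a r q0 h0 v0 :
    (forall k, cf_state k = VDo q0 a -> cf_ihead k = h0 -> holds k v0 ->
       unit_reg k -> cert_left x k = a :: r -> e <= halt_prob honest x true n k) ->
    forall k, cf_state k = VAsk q0 -> cf_ihead k = h0 -> holds k v0 ->
      unit_reg k -> cert_left x k = a :: r -> e <= halt_prob honest x true n.+1 k.
  move=> H k kq kh kv uk kl.
  have kc : v_kind (cf_state k) = Communication by rewrite kq.
  rewrite (halt_prob_comm _ _ _ _ kc); apply: H => //.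
    by rewrite (state_comm x _ kq) (answer_honest kl).
  by rewrite cert_left_comm.
elim=> [a {}q {}h {}v ps iN|a r {}q q' {}h {}v ps iN _ IH] v1;
  set i := ginstr x q a h in ps iN *;
  pose s := iscale R i ^+ 2 / sqnorm (vec R v);
  have s0 : 0 < s by
    [rewrite divr_gt0 ?exprn_gt0 ?iscale_gt0 //;
     have := @sqnorm_vec_ge1 R S G v v1; lra].
- exists 2%N, s => //; apply: ask => k kq kh kv uk _.
  rewrite (halt_prob_do x kq) mulr0 addr0.
  have sp := @read_prob_upd_ge R S G x k q a v kq kv uk; rewrite kh -/i -/s in sp.
  rewrite [X in _ * X + _]halt_prob_accepting ?mulr1; last first.
    by rewrite (state_do_next x kq) kh -/i iN.
  apply: (le_trans sp); rewrite lerDl.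
  by apply: sumr_ge0 => w _; rewrite ?mulr_ge0 ?read_prob_ge0 ?halt_prob_ge0.
- have [|n [e e0 He]] := IH; first by rewrite gupd_cst.
  exists n.+2, (s * e); first by rewrite mulr_gt0.
  apply: ask => k kq kh kv uk kl; rewrite (halt_prob_do x kq) mulr0 addr0.
  have sp := @read_prob_upd_ge R S G x k q a v kq kv uk; rewrite kh -/i -/s in sp.
  have p0 : 0 < read_prob x k (inl true) by exact: lt_le_trans sp.
  apply: (@le_trans _ _ (read_prob x k (inl true)
    * halt_prob honest x true n (read_step x k (inl true)))).
    apply: ler_pM; rewrite ?(ltW s0) ?(ltW e0) //; apply: He.
    + by rewrite (state_do_next x kq) kh -/i iN.
    + by rewrite (ihead_do x kq) kh.
    + by have := holds_next x kq kv; rewrite kh.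
    + exact: unit_reg_read.
    + exact: (cert_left_do kq kl).
  rewrite lerDl.
  by apply: sumr_ge0 => w _; rewrite ?mulr_ge0 ?read_prob_ge0 ?halt_prob_ge0.
Qed.

Hypothesis cert_wins : winning x (cert x) (g_start G) 0 (@gvect0 S G).

Definition fine k : Prop :=
  match cf_state k with
  | VAsk q => exists2 v, holds k v & winning x (cert_left x k) q (cf_ihead k) v
  | VDo q a => exists2 v, holds k v &
      (exists l, cert_left x k = a :: l) /\
      winning x (cert_left x k) q (cf_ihead k) v
  | VReject => False
  | _ => True
  end.

Lemma fine_ask k q : cf_state k = VAsk q -> fine k -> fine (comm_step honest x k).
Proof.
move=> kq; rewrite /fine kq (state_comm x honest kq) => -[v kv kw].
exists v; first exact: kv.
rewrite cert_left_comm; split=> //.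
suff [a [l E]] : exists a l, cert_left x k = a :: l.
  by rewrite (answer_honest E) E; exists l.
by case: kw => [a|a l] *; [exists a, [::]|exists a, l].
Qed.

Lemma fine_do k q a : cf_state k = VDo q a -> fine k -> fine (read_step x k (inl true)).
Proof.
move=> kq; rewrite /fine kq (state_do_next x kq) => -[v kv [[l kl]]].
rewrite kl => kw; case iN: (i_next _) => [q'|] //.
exists (gupd (ginstr x q a (cf_ihead k)) v); first exact: holds_next.
rewrite (cert_left_do kq kl) (ihead_do x kq).
by have [_] := winning_inv kw; apply.
Qed.

Lemma fine_pass k q a : cf_state k = VDo q a -> fine k ->
  read_prob x k (inl false) = 0.
Proof.
move=> kq; rewrite /fine kq => -[v kv [[l kl]]]; rewrite kl => kw.
by apply: (read_prob_pass kq kv); have [] := winning_inv kw.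
Qed.

(** The tests of the honest play hold exactly, so the rejecting outcome has probability 0, and a
    restart brings the whole certificate back. *)
Lemma honest_never_rejected t k : unit_reg k -> fine k ->
  halt_prob honest x false t k = 0.
Proof.
elim: t k => [|t IH] k uk fk; case kq: (cf_state k) => [|q|q a||];
  try by rewrite /fine kq in fk.
- by rewrite /= kq.
- by rewrite /= kq.
- by rewrite /= kq.
- by rewrite /= kq.
- rewrite (halt_prob_restart x kq).
  have p0 : 0 < read_prob x k (restart_symb G).
    by rewrite (read_prob_restart x kq) eqxx.
  apply: (IH _ (unit_reg_read p0)); rewrite /fine.
  case: (restart_cases x kq (restart_symb G)) => [[k0 [k1 ->]]|[_ [_ ->]]] //.
  exists (@gvect0 S G); first exact: holds_restart.
  by rewrite k1 (cert_left_restart x kq).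
- have kc : v_kind (cf_state k) = Communication by rewrite kq.
  rewrite (halt_prob_comm _ _ _ _ kc); apply: IH; first exact: uk.
  exact: fine_ask kq fk.
- rewrite (halt_prob_do x kq) (fine_pass kq fk) mul0r addr0.
  rewrite big1 ?addr0 => [|w _].
    have [p0|p0] := ltP 0 (read_prob x k (inl true)).
      by rewrite IH ?mulr0 //; [exact: unit_reg_read|exact: fine_do kq fk].
    by rewrite (read_prob_le0 p0) mul0r.
  have [p0|p0] := ltP 0 (read_prob x k (inr (inr w))).
    rewrite IH ?mulr0 //; first exact: unit_reg_read.
    by rewrite /fine (state_do_restart x kq).
  by rewrite (read_prob_le0 p0) mul0r.
- have ka : v_kind (cf_state k) = Accepting by rewrite kq.
  by rewrite (halt_prob_accepting _ _ _ _ ka).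
Qed.

(** A verifier that halts almost surely and never rejects accepts with probability 1. *)
Lemma honest_accepted : accept_prob R honest x = 1.
Proof.
apply: accept_prob_eq1 => a a0.
have [|N [e e0 He]] := winning_accepted cert_wins; first by rewrite /gvect0 eqxx.
have [|t Ht] := @game_halts R S G x honest e N e0 _ a a0.
  move=> k hs kq kh kv uk kl; apply: le_trans (He k kq kh kv uk _) _.
    (* The history ends with a restart, so the count of moves is 0 and nothing of the certificate is
       used up. *)
    by rewrite /cert_left kl /moves_played foldl_rcons drop0.
  by rewrite lerDl halt_prob_ge0.
exists t; move: Ht; rewrite /some_halt_prob honest_never_rejected ?addr0 //.
exact: unit_reg_initial.
Qed.

End Word.
End HonestProver.

Section GameTheorem.
Variables (R : realType) (S : finType) (G : game S).

Lemma vtrans_stay (s : vstate G) y w c : (vtrans s y w c).2 = Stay.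
Proof. by case: s => [|q|q a||] //=; case: y. Qed.

Lemma game_whead P x (k : config R (game_verifier G)) :
  reachable P x k -> cf_whead k = 0%N.
Proof.
elim=> // {}k c _ k0 _ _; rewrite /read_step.
have := vtrans_stay (cf_state k) (input_at x (cf_ihead k))
  (cf_tape k (cf_whead k)) c.
rewrite -[vtrans _ _ _ _]/(v_trans (v := game_verifier G) _ _ _ _).
by case: v_trans => [[[q m] b] w] /= ->.
Qed.

Lemma game_reject_prob (x : seq S) (P : prover (game_verifier G)) :
  doomed x (g_start G) 0 (@gvect0 S G) -> 3%:R / 5%:R < reject_prob R P x.
Proof.
move=> xd; have [|N [e e0 He]] := doomed_rejected R xd.
  by rewrite /gvect0 eqxx.
(* By time [t] the verifier has halted with probability above 4/5; as acceptance is at most a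
   quarter of rejection, rejection exceeds 16/25, hence 3/5. *)
have a0 : 0 < 1 / 5%:R :> R by lra.
have [|t Ht] := @game_halts R S G x P e N e0 _ _ a0.
  move=> k hs kq kh kv uk kl; apply: le_trans (He P k kq kh kv uk) _.
  by rewrite lerDr halt_prob_ge0.
apply: lt_le_trans (@halt_prob_le_lim R S _ P x false t).
have [H _] := accept_le_reject P t xd (@unit_reg_initial R S _).
by move: Ht (H I); rewrite /some_halt_prob; lra.
Qed.

Theorem game_qAM1 (L : language S) :
  (forall x, L x -> exists l, winning x l (g_start G) 0 (@gvect0 S G)) ->
  (forall x, ~ L x -> doomed x (g_start G) 0 (@gvect0 S G)) ->
  qAM1 R log2n L.
Proof.
move=> Lwin Ldoom.
have /choice[cert Hcert] x : exists l, L x -> winning x l (g_start G) 0 (@gvect0 S G).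
  have [Lx|nLx] := pselect (L x); last by exists [::].
  by have [l wl] := Lwin x Lx; exists l.
exists (game_verifier G), (honest cert), (2%:R / 5%:R); split.
(* The work head never moves, and the constant 1 is dominated by the logarithm from length 2 on. *)
- exists (fun=> 1%N).
    exists 1%N, 2%N => n n2; rewrite mul1n /log2n.
    by rewrite trunc_log_gt0 // n2.
  by move=> P x k /game_whead ->.
- lra.
- by move=> x Lx; apply: honest_accepted; exact: Hcert.
- move=> x nLx P; have := game_reject_prob P (Ldoom x nLx); lra.
Qed.

End GameTheorem.

Local Open Scope nat_scope.

(** * The game of a deterministic machine *)

Lemma input_at_left (T : Type) (x : seq T) h : input_at x h = LeftEnd -> h = 0.
Proof.
case: h => // h; rewrite /input_at /=.
by elim: x h => [|y x IH] [|h] //=; [rewrite nth_nil|move/IH].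
Qed.

Lemma input_at_letter (T : Type) (s1 s2 : seq T) a :
  input_at (s1 ++ a :: s2) (size s1).+1 = Letter a.
Proof.
by rewrite /input_at /= map_cat rcons_cat nth_cat size_map ltnn subnn.
Qed.

Lemma input_at_right (T : Type) (x : seq T) : input_at x (size x).+1 = RightEnd.
Proof. by rewrite /input_at /= nth_rcons size_map ltnn eqxx. Qed.

Lemma input_at_beyond (T : Type) (x : seq T) h :
  size x < h -> input_at x h = RightEnd.
Proof.
by case: h => // h xh; rewrite /input_at /= nth_rcons size_map ltnNge -ltnS xh if_same.
Qed.

Lemma input_at_not_right (T : Type) (x : seq T) h :
  h <= size x -> input_at x h <> RightEnd.
Proof.
rewrite /input_at; case: h => //= h; elim: x h => [|y x IH] [|h] //=.
exact: IH.
Qed.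

Lemma feval_cons (T : Type) m (c : T) f v :
  feval ((m, c) :: f) v = m * v c + feval f v.
Proof. by rewrite /feval big_cons. Qed.

Lemma feval_nil (T : Type) (v : T -> nat) : feval [::] v = 0.
Proof. by rewrite /feval big_nil. Qed.

Definition fevalE := (feval_cons, feval_nil, mul1n, addn0).

Section DeterministicSteps.
Variables (S : finType) (G : game S) (x : seq S).

Definition wins (q : g_ctrl G) (h : nat) (v : g_coord G -> nat) : Prop :=
  exists l, winning x l q h v.

(** Loading the input and rewinding the head leave the prover no choice. This closure property is
    shared by [wins] and [doomed], so these phases are treated once for both. *)
Definition step_closed (Q : g_ctrl G -> nat -> (g_coord G -> nat) -> Prop) :=
  forall i q h v q', (forall a, ginstr x q a h = i) -> i_lhs i = i_rhs i ->
    i_next i = Some q' -> Q q' (ghead x i h) (gupd i v) -> Q q h v.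

Lemma wins_move a q q' h v (i := ginstr x q a h) : passes i v ->
  i_next i = Some q' -> wins q' (ghead x i h) (gupd i v) -> wins q h v.
Proof. by move=> ps iN [l wl]; exists (a :: l); exact: winning_move iN wl. Qed.

Lemma step_closed_wins : step_closed wins.
Proof.
move=> i q h v q' qi ii iN H.
apply: (wins_move (a := g_ans0 G) (q' := q')); rewrite qi //.
by rewrite /passes ii.
Qed.

Lemma step_closed_doomed : step_closed (@doomed S G x).
Proof.
move=> i q h v q' qi ii iN H; apply: Doomed => [a _|a q'' _].
  by rewrite qi iN.
by rewrite qi iN => -[<-].
Qed.

Lemma gupdE (i : instr (g_ctrl G) (g_coord G)) v c :
  i_next i -> c != g_cst G -> gupd i v c = feval (i_upd i c) v.
Proof. by rewrite /gupd /eff_upd => + /negPf->; case: i_next. Qed.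

End DeterministicSteps.

(** * Infinite words as numbers in base b *)

Section Stacks.
Variables (A : Type) (b : nat) (code : A -> nat).
Hypothesis code_lt : forall a, code a < b.
Hypothesis code_inj : injective code.

(* The base-[b] digits of [w], least significant first, are the codes of the
   infinite word [f]. *)
Definition encodes (w : nat) (f : nat -> A) : Prop :=
  forall j, (w %/ b ^ j) %% b = code (f j).

Let b_gt0 (a : A) : 0 < b.
Proof. exact: leq_ltn_trans (code_lt a). Qed.

Lemma encodes_pop w f y a : encodes w f -> w = b * y + code a ->
  a = f 0 /\ encodes y (fun j => f j.+1).
Proof.
move=> wf wE; have b0 := b_gt0 a.
have wd : w %/ b = y by rewrite wE mulnC divnMDl // divn_small ?addn0.
split=> [|j]; last by rewrite -wf expnS divnMA wd.
by apply: code_inj; rewrite -wf expn0 divn1 wE mulnC modnMDl modn_small.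
Qed.

Lemma encodes_push y f a : encodes y f ->
  encodes (b * y + code a) (fun j => if j is j'.+1 then f j' else a).
Proof.
move=> yf; have b0 := b_gt0 a; case=> [|j].
  by rewrite expn0 divn1 mulnC modnMDl modn_small.
rewrite expnS divnMA mulnC divnMDl // (divn_small (code_lt a)) addn0.
exact: yf.
Qed.

Lemma encodes_head w f : encodes w f -> w = b * (w %/ b) + code (f 0).
Proof. by move=> /(_ 0); rewrite expn0 divn1 => <-; rewrite mulnC -divn_eq. Qed.

Lemma eq_encodes w f g : f =1 g -> encodes w f -> encodes w g.
Proof. by move=> fg wf j; rewrite -fg. Qed.

End Stacks.

(** * Counters, replies and instructions of the simulation *)

Section DtmGame.
Variables (S : finType) (M : dtm S) (b : nat).

Local Notation tape := 'I_(dtm_extra M).+1.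
Local Notation sym := (option (S + dtm_aux M)%type).

(* The contents of a tape is split at the head into two infinite words, the
   scanned cell being the first letter of the word [(i, true)]. *)
Local Notation stack := (tape * bool)%type.

(** The blank has code 0, so that the number 0 encodes a blank half tape. *)
Definition sym_code (g : sym) : nat := if g is Some c then (enum_rank c).+1 else 0.

(* [Msg1], [Msg2], [Msg3] accumulate the digits of the current message of
   level 1, 2, 3; [Prev1], [Prev2] hold the previous message of level 1, 2. *)
Inductive counter :=
  One | Power | Msg1 | Msg2 | Msg3 | Prev1 | Prev2 | Stack of stack.

Definition counter_code (c : counter) : 'I_7 + stack :=
  match c with
  | One => inl (@Ordinal 7 0 isT) | Power => inl (@Ordinal 7 1 isT)
  | Msg1 => inl (@Ordinal 7 2 isT) | Msg2 => inl (@Ordinal 7 3 isT)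
  | Msg3 => inl (@Ordinal 7 4 isT) | Prev1 => inl (@Ordinal 7 5 isT)
  | Prev2 => inl (@Ordinal 7 6 isT) | Stack s => inr s
  end.
Definition counter_decode (c : 'I_7 + stack) : counter :=
  match c with
  | inl j => nth One [:: One; Power; Msg1; Msg2; Msg3; Prev1; Prev2] j
  | inr s => Stack s
  end.
Lemma counter_codeK : cancel counter_code counter_decode.
Proof. by case. Qed.

HB.instance Definition _ := Finite.copy counter (can_type counter_codeK).

Inductive reply :=
  | Digit1 of 'I_b | Digit2 of 'I_b | Digit3 of 'I_b
  | Pop of stack & sym | Transition.

Definition reply_code (a : reply) : 'I_b + 'I_b + 'I_b + stack * sym + unit :=
  match a with
  | Digit1 d => inl (inl (inl (inl d))) | Digit2 d => inl (inl (inl (inr d)))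
  | Digit3 d => inl (inl (inr d)) | Pop s g => inl (inr (s, g))
  | Transition => inr tt
  end.
Definition reply_decode (a : 'I_b + 'I_b + 'I_b + stack * sym + unit) : reply :=
  match a with
  | inl (inl (inl (inl d))) => Digit1 d | inl (inl (inl (inr d))) => Digit2 d
  | inl (inl (inr d)) => Digit3 d | inl (inr (s, g)) => Pop s g
  | inr tt => Transition
  end.
Lemma reply_codeK : cancel reply_code reply_decode.
Proof. by case. Qed.

HB.instance Definition _ := Finite.copy reply (can_type reply_codeK).

(* [None] while the input is loaded; otherwise the state of the machine, the
   letters popped so far, and whether [Prev1], [Prev2] are still unset. *)
Definition phase : finType :=
  option (dtm_state M * {ffun stack -> option sym} * bool * bool)%type.

(* The boolean tells whether the input head is being rewound. *)
Definition control : finType := (bool * phase)%type.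

Local Notation instr := (instr control counter).

Definition keep (c : counter) : seq (nat * counter) := [:: (1, c)].

(** The test is 0 = 1, since [One] always holds 1. *)
Definition lose : instr := Instr keep [::] [:: (1, One)] None Stay.
Definition win : instr := Instr keep [::] [::] None Stay.

Definition clear_msgs (c : counter) : seq (nat * counter) :=
  match c with Msg1 | Msg2 | Msg3 => [::] | _ => keep c end.

Definition all_popped (D : {ffun stack -> option sym}) : bool :=
  [forall s, D s != None].

Definition popped (D : {ffun stack -> option sym}) (s : stack) : sym :=
  odflt None (D s).

Definition dtm_action q (D : {ffun stack -> option sym}) :=
  dtm_trans q [ffun i => popped D (i, true)].

(** The scanned cell and its left neighbour have both been popped, so a transition of the machine
    pushes at most two letters on what remains of each stack. *)
Definition move_stack q D (s : stack) : seq (nat * counter) :=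
  let: (g, m) := (dtm_action q D).2 s.1 in
  let l := sym_code (popped D (s.1, false)) in
  let w := sym_code g in
  match m, s.2 with
  | Stay, true => [:: (b, Stack s); (w, One)]
  | Stay, false => [:: (b, Stack s); (l, One)]
  | MoveRight, true | MoveLeft, false => [:: (1, Stack s)]
  | MoveRight, false => [:: (b * b, Stack s); (b * l + w, One)]
  | MoveLeft, true => [:: (b * b, Stack s); (b * w + l, One)]
  end.

Definition unpopped : {ffun stack -> option sym} := [ffun=> None].

(** The input tape bounds the length of a message of level 1, since each of its digits moves the
    head to the right. A digit of level 2 or 3 closes the message below it; the flags [f1] and [f2]
    waive the comparison for the first such message, and [Digit3] sets [f1] again so that level 1
    may count down anew. *)
Definition play_instr q D (f1 f2 : bool) (a : reply) (y : input_symbol S) : instr :=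
  match a with
  | Digit1 d =>
      if y is RightEnd then lose else
      Instr (fun c => if c is Msg1 then [:: (b, Msg1); (d : nat, One)] else keep c)
        [::] [::] (Some (false, Some (q, D, f1, f2))) MoveRight
  | Digit2 d =>
      Instr (fun c => match c with
                      | Msg2 => [:: (b, Msg2); (d : nat, One)]
                      | Prev1 => keep Msg1 | Msg1 => [::] | _ => keep c
                      end)
        (if f1 then [::] else [:: (1, Msg1); (1, One)])
        (if f1 then [::] else [:: (1, Prev1)])
        (Some (true, Some (q, D, false, f2))) Stay
  | Digit3 d =>
      Instr (fun c => match c with
                      | Msg3 => [:: (b, Msg3); (d : nat, One)]
                      | Prev2 => keep Msg2 | Msg1 | Msg2 => [::] | _ => keep c
                      end)
        (if f2 then [::] else [:: (1, Msg2); (1, One)])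
        (if f2 then [::] else [:: (1, Prev2)])
        (Some (true, Some (q, D, true, false))) Stay
  | Pop s g =>
      if D s is Some _ then lose else
      Instr (fun c => if c == Stack s then keep Msg3 else clear_msgs c)
        [:: (1, Stack s)] [:: (b, Msg3); (sym_code g, One)]
        (Some (true, Some (q, [ffun s' => if s' == s then Some g else D s'],
                           true, true))) Stay
  | Transition =>
      if ~~ all_popped D then lose else
      match dtm_halt q with
      | Some true => win
      | Some false => lose
      | None =>
          Instr (fun c => if c is Stack s then move_stack q D s else clear_msgs c)
            [::] [::] (Some (true, Some ((dtm_action q D).1, unpopped, true, true)))
            Stay
      end
  end.

(** The first letter must end on top of the stack although it is read first; hence each letter is
    added at the weight [Power], the power of b for its position. *)
Definition load_instr (y : input_symbol S) : instr :=
  match y with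
  | LeftEnd =>
      Instr (fun c => if c is Power then keep One else keep c) [::] [::]
        (Some (false, None)) MoveRight
  | Letter a =>
      Instr (fun c => if c is Power then [:: (b, Power)]
                      else if c == Stack (ord0, true)
                      then [:: (1, c); (sym_code (Some (inl a)), Power)]
                      else keep c)
        [::] [::] (Some (false, None)) MoveRight
  | RightEnd =>
      Instr keep [::] [::] (Some (true, Some (dtm_start M, unpopped, true, true))) Stay
  end.

Definition rewind_instr (p : phase) (y : input_symbol S) : instr :=
  if y is LeftEnd then Instr keep [::] [::] (Some (false, p)) Stay
  else Instr keep [::] [::] (Some (true, p)) MoveLeft.

Definition dtm_instr (q : control) (a : reply) (y : input_symbol S) : instr :=
  match q with
  | (true, p) => rewind_instr p y
  | (false, None) => load_instr y
  | (false, Some (q, D, f1, f2)) => play_instr q D f1 f2 a y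
  end.

Definition dtm_game : game S :=
  @Game S control reply counter Transition One (false, None) dtm_instr.

End DtmGame.

Arguments One {S M}.
Arguments Power {S M}.
Arguments Msg1 {S M}.
Arguments Msg2 {S M}.
Arguments Msg3 {S M}.
Arguments Prev1 {S M}.
Arguments Prev2 {S M}.
Arguments Stack {S M}.

Section OptionOrder.

(* [None] stands for infinity. *)
Definition olt (a b : option nat) : Prop :=
  match a, b with
  | Some m, Some n => m < n | Some _, None => True | None, _ => False
  end.

Lemma olt_wf : well_founded olt.
Proof.
have some n : Acc olt (Some n).
  elim/ltn_ind: n => n IH; apply: Acc_intro => -[k|nk]; first exact: IH.
  by case: nk.
case=> [n|]; first exact: some.
by apply: Acc_intro => -[k|nk]; [move=> _; exact: some|case: nk].
Qed.

Lemma ltn_wf : well_founded (fun m n : nat => m < n).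
Proof. by move=> n; elim/ltn_ind: n => n IH; apply: Acc_intro; exact: IH. Qed.

End OptionOrder.

(** * Counters that represent a configuration *)

Section DtmGameFacts.
Variables (S : finType) (M : dtm S) (b : nat) (x : seq S).
Hypothesis b_large : #|{: S + dtm_aux M}| < b.

Local Notation G := (dtm_game M b).
Local Notation tape := 'I_(dtm_extra M).+1.
Local Notation sym := (option (S + dtm_aux M)%type).
Local Notation stack := (tape * bool)%type.
Local Notation counter := (counter M).
Local Notation vect := (counter -> nat).
Local Notation code := (@sym_code S M).
Local Notation encodes := (encodes b code).
Local Notation doomed := (@doomed S G x).
Local Notation wins := (@wins S G x).
Implicit Types (c : dtm_config M) (D : {ffun stack -> option sym}) (v : vect).

Lemma sym_code_lt g : code g < b.
Proof.
case: g => [g|] /=; last exact: leq_ltn_trans b_large.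
exact: leq_ltn_trans (ltn_ord _) b_large.
Qed.

Lemma sym_code_inj : injective code.
Proof. by case=> [g|] [h|] //= [/ord_inj/enum_rank_inj->]. Qed.

Lemma gupd_game (i : instr (control M) counter) v (y : counter) :
  i_next i -> y != One -> gupd (G := G) i v y = feval (i_upd i y) v.
Proof. exact: (@gupdE S G i v y). Qed.

Lemma gupd_one (i : instr (control M) counter) v : gupd (G := G) i v One = v One.
Proof. exact: (@gupd_cst S G). Qed.

Lemma gupd_keep (i : instr (control M) counter) v :
  i_next i -> i_upd i = @keep S M -> gupd (G := G) i v =1 v.
Proof.
move=> iN iK c; have [->|c1] := eqVneq c One; first exact: gupd_one.
by rewrite gupd_game // iK /keep !fevalE.
Qed.

(** Each step of the rewinding rebuilds the counters, so they are followed up to pointwise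
    equality. *)
Lemma rewind_closed (Q : control M -> nat -> vect -> Prop) p h v :
  step_closed (G := G) x Q ->
  (forall v', v' =1 v -> Q (false, p) 0 v') -> Q (true, p) h v.
Proof.
move=> clQ Q0; have [m] := ubnP h; elim: m h v Q0 => // m IH h v Q0 hm.
pose i := rewind_instr p (input_at x h).
case E: (input_at x h) => [|a|].
- apply: (clQ i) => //; rewrite /i E // (input_at_left E) /ghead /= min0n.
  by apply: Q0; exact: gupd_keep.
- apply: (clQ i (true, p) _ _ (true, p)) => //; rewrite /i E //; apply: IH.
    move=> v' vv'; apply: Q0 => c; rewrite vv'; exact: gupd_keep.
  have : h != 0 by apply/eqP => h0; rewrite h0 in E.
  rewrite /ghead /=; lia.
- apply: (clQ i (true, p) _ _ (true, p)) => //; rewrite /i E //; apply: IH.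
    move=> v' vv'; apply: Q0 => c; rewrite vv'; exact: gupd_keep.
  have : h != 0 by apply/eqP => h0; rewrite h0 in E.
  rewrite /ghead /=; lia.
Qed.

Definition content (c : dtm_config M) (s : stack) (j : nat) : sym :=
  dc_tape c s.1 (if s.2 then dc_head c s.1 + j%:Z else dc_head c s.1 - 1 - j%:Z)%R.

Definition represents (c : dtm_config M) (D : {ffun stack -> option sym})
    (v : vect) : Prop :=
  v One = 1 /\ forall s,
    match D s with
    | None => encodes (v (Stack s)) (content c s)
    | Some g => g = content c s 0
                /\ encodes (v (Stack s)) (fun j => content c s j.+1)
    end.

Lemma represents_ext c D v v' : represents c D v -> v' One = v One ->
  (forall s, v' (Stack s) = v (Stack s)) -> represents c D v'.
Proof.
move=> [v1 vD] e1 eD; split=> [|s]; first by rewrite e1.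
by rewrite eD; exact: vD.
Qed.

Lemma represents_pop c D v s y g v' : represents c D v -> D s = None ->
  v (Stack s) = b * y + code g -> v' One = v One -> v' (Stack s) = y ->
  (forall s', s' != s -> v' (Stack s') = v (Stack s')) ->
  represents c [ffun s' => if s' == s then Some g else D s'] v'.
Proof.
move=> [v1 vD] Ds vs e1 es eD; split=> [|s']; first by rewrite e1.
rewrite ffunE; case: eqVneq => [->|ss']; last by rewrite eD //; exact: vD.
have := vD s; rewrite Ds es => H.
exact: (encodes_pop sym_code_lt sym_code_inj H vs).
Qed.

Lemma all_poppedP D s : all_popped D -> D s = Some (popped D s).
Proof. by move=> /forallP/(_ s); rewrite /popped; case: (D s). Qed.

Section Transition.
Variables (c : dtm_config M) (D : {ffun stack -> option sym}) (v : vect).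
Hypotheses (cv : represents c D v) (allD : all_popped D).
Hypothesis c_running : dtm_halt (dc_state c) = None.

Let action := dtm_action (dc_state c) D.

Lemma dtm_step_popped : dtm_step c =
  DtmConfig action.1
    (fun i p => if (p == dc_head c i)%R then (action.2 i).1 else dc_tape c i p)
    (fun i => move_int (action.2 i).2 (dc_head c i)).
Proof.
rewrite /dtm_step c_running.
have -> : [ffun i => dc_tape c i (dc_head c i)] = [ffun i => popped D (i, true)].
  apply/ffunP => i; rewrite !ffunE; have := cv.2 (i, true).
  by rewrite (all_poppedP _ allD) /content /= addr0 => -[].
by rewrite /action /dtm_action; case: dtm_trans.
Qed.

Lemma represents_move v' : v' One = v One ->
  (forall s, v' (Stack s) = feval (move_stack b (dc_state c) D s) v) ->
  represents (dtm_step c) (unpopped M) v'.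
Proof.
move=> e1 es; split=> [|s]; first by rewrite e1 cv.1.
rewrite ffunE es /move_stack -/action.
have Hs t : popped D t = content c t 0
    /\ encodes (v (Stack t)) (fun j => content c t j.+1).
  by have := cv.2 t; rewrite (all_poppedP _ allD).
have [_ ES] := Hs s; have [-> _] := Hs (s.1, false).
rewrite dtm_step_popped; case: s ES => i r ES.
pose push := encodes_push sym_code_lt.
rewrite [(i, r).1]/=; case E: (action.2 i) => [g m].
have old (p p' : int) : p != dc_head c i -> p = p' ->
    dc_tape c i p' = (if p == dc_head c i then g else dc_tape c i p).
  by move=> /negPf-> ->.
have new (p : int) : p = dc_head c i ->
    g = (if p == dc_head c i then g else dc_tape c i p).
  by move=> ->; rewrite eqxx.
set l := content c (i, false) 0.
(* The six cases are the three moves, each for the right and then the left half of the tape; two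
   letters are pushed on the half that grows. *)
case: m E; case: r ES => ES E; rewrite ?fevalE ?cv.1 ?muln1.
- rewrite addnA -mulnA -mulnDr.
  apply: eq_encodes (push _ _ l (push _ _ g ES)) => -[|[|j]];
    rewrite ?/l /content /= E /=; first [apply: old; lia|apply: new; lia].
- by apply: eq_encodes ES => j; rewrite /content /= E /=; apply: old; lia.
- apply: eq_encodes (push _ _ g ES) => -[|j];
    rewrite ?/l /content /= E /=; first [apply: old; lia|apply: new; lia].
- apply: eq_encodes (push _ _ l ES) => -[|j];
    rewrite ?/l /content /= E /=; first [apply: old; lia|apply: new; lia].
- by apply: eq_encodes ES => j; rewrite /content /= E /=; apply: old; lia.
- rewrite addnA -mulnA -mulnDr.
  apply: eq_encodes (push _ _ g (push _ _ l ES)) => -[|[|j]];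
    rewrite ?/l /content /= E /=; first [apply: old; lia|apply: new; lia].
Qed.

End Transition.

(** * Rejected inputs: every play fails a test *)

Lemma rewind_doomed p h v : (forall v', v' =1 v -> doomed (false, p) 0 v') ->
  doomed (true, p) h v.
Proof. by apply: rewind_closed; exact: step_closed_doomed. Qed.

Lemma loseP v : v One = 1 -> ~ passes (G := G) (lose M) v.
Proof. by move=> v1; rewrite /passes /= !fevalE v1. Qed.

Definition rest D : nat := #|[pred s | D s == None]|.

Lemma rest_pop D s g : D s = None ->
  rest [ffun s' => if s' == s then Some g else D s'] < rest D.
Proof.
move=> Ds; apply: proper_card; apply/properP; split.
  by apply/fintype.subsetP => s'; rewrite !inE ffunE; case: (s' == s).
by exists s; rewrite !inE ?ffunE ?eqxx ?Ds.
Qed.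

Local Notation slex := Relation_Operators.slexprod.
Local Notation lt := (fun m n : nat => m < n).

(* Every answer that passes its test decreases [play_measure] for this order,
   hence the termination of the game. *)
Definition play_lt :=
  slex _ _ lt (slex _ _ lt (slex _ _ olt (slex _ _ olt lt))).

Lemma play_lt_wf : well_founded play_lt.
Proof.
by do ![apply: Lexicographic_Product.wf_slexprod; try exact: ltn_wf;
  try exact: olt_wf].
Qed.

(** In order of weight: the steps left to the machine, the stacks left to pop, the previous messages
    of levels 2 and 1, and the room left to the input head. An unset previous message counts as
    infinite. *)
Definition play_measure (n : nat) D (f1 f2 : bool) v (h : nat) :=
  (n, (rest D, (if f2 then None else Some (v Prev2),
    (if f1 then None else Some (v Prev1), (size x).+1 - h)))).

Lemma iter_halted c n r : dtm_halt (dc_state c) = Some r ->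
  iter n (@dtm_step S M) c = c.
Proof.
by move=> cr; elim: n => //= n ->; rewrite /dtm_step cr.
Qed.

(** The test of [Pop] determines both the letter and the rest of the stack, by uniqueness of
    division by b. So the counters follow the true run whatever the prover answers, and that run
    never reaches an accepting state. *)
Lemma play_doomed n c D f1 f2 v h :
  dtm_halt (dc_state (iter n (@dtm_step S M) c)) = Some false ->
  represents c D v -> doomed (false, Some (dc_state c, D, f1, f2)) h v.
Proof.
move E: (play_measure n D f1 f2 v h) => mu.
elim: (play_lt_wf mu) => {}mu _ IH in n c D f1 f2 v h E *.
move=> halted cv; have v1 := cv.1.
pose i (a : reply M b) := play_instr (dc_state c) D f1 f2 a (input_at x h).
have not_lost a : passes (G := G) (i a) v -> i a <> lose M.
  by move=> + ia; rewrite ia; exact: loseP.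
suff H a : passes (G := G) (i a) v ->
    exists2 q', i_next (i a) = Some q' &
      doomed q' (ghead (G := G) x (i a) h) (gupd (G := G) (i a) v).
  apply: Doomed => [a ps|a q' ps iN].
    by have [q'] := H a ps; rewrite /ginstr /= -/(i a) => ->.
  have [q''] := H a ps; rewrite /ginstr /= -/(i a) in iN *.
  by rewrite iN => -[<-].
move=> ps; have nl := not_lost a ps.
have old (j : instr _ _) (y : counter) : i_next j -> y != One ->
    i_upd j y = keep y -> gupd (G := G) j v y = v y.
  by move=> jN y1 jy; rewrite gupd_game // jy /keep !fevalE.
have one j : gupd (G := G) j v One = v One by exact: gupd_one.
have ext j : i_next j -> (forall s, i_upd j (Stack s) = keep (Stack s)) ->
    represents c D (gupd (G := G) j v).
  by move=> jN js; apply: (represents_ext cv (one j)) => s; exact: old.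
move: ps nl; rewrite /i; case: a => [d|d|d|s g|] /=.
- have hx : input_at x h <> RightEnd -> h <= size x.
    by move=> y; rewrite leqNgt; apply/negP => /input_at_beyond.
  case y: (input_at x h) hx => [|a|] hx ps nl //=; (eexists; first reflexivity);
    (apply: IH; [|reflexivity|exact: halted|by apply: ext]);
    rewrite -E /play_lt /play_measure; apply: Relation_Operators.right_slex;
    apply: Relation_Operators.right_slex; rewrite !old //;
    apply: Relation_Operators.right_slex; apply: Relation_Operators.right_slex;
    rewrite /ghead /=; have := hx ltac:(by []); lia.
- rewrite /passes /= => ps _; eexists; first reflexivity.
  apply: rewind_doomed => v' vv'; apply: IH; [|reflexivity|exact: halted|]; last first.
    by apply: (represents_ext cv) => [|s]; rewrite vv' ?one ?old.
  rewrite -E /play_lt /play_measure; apply: Relation_Operators.right_slex.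
  apply: Relation_Operators.right_slex; rewrite !vv' !(old _ Prev2) //.
  apply: Relation_Operators.right_slex; apply: Relation_Operators.left_slex.
  rewrite gupd_game //= !fevalE.
  (* The first message replaces infinity by a number; a later one is the predecessor of the one
     before. *)
  by case: (f1) ps => //=; rewrite !fevalE v1 => <-; rewrite addn1.
- rewrite /passes /= => ps _; eexists; first reflexivity.
  apply: rewind_doomed => v' vv'; apply: IH; [|reflexivity|exact: halted|]; last first.
    by apply: (represents_ext cv) => [|s]; rewrite vv' ?one ?old.
  rewrite -E /play_lt /play_measure; apply: Relation_Operators.right_slex.
  apply: Relation_Operators.right_slex; apply: Relation_Operators.left_slex.
  rewrite !vv' gupd_game //= !fevalE.
  by case: (f2) ps => //=; rewrite !fevalE v1 => <-; rewrite addn1.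
- case Ds: (D s) => [g'|]; first by move=> _ [].
  rewrite /passes /= !fevalE v1 muln1 => ps _; eexists; first reflexivity.
  apply: rewind_doomed => v' vv'; apply: IH; [|reflexivity|exact: halted|].
    rewrite -E /play_lt /play_measure; apply: Relation_Operators.right_slex.
    by apply: Relation_Operators.left_slex; exact: rest_pop.
  apply: (represents_pop (y := v Msg3) cv Ds ps).
  + by rewrite vv' one.
  + by rewrite vv' gupd_game //= eqxx /keep !fevalE.
  + move=> s' ss'; rewrite vv' gupd_game //=.
    have /negPf-> : Stack s' != Stack s by apply: contra ss' => /eqP[->].
    by rewrite /keep !fevalE.
- case: ifP => [|/negbFE allD]; first by move=> _ _ [].
  case cr: (dtm_halt (dc_state c)) => [[]|].
  + by move: halted; rewrite (iter_halted n cr) cr.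
  + by move=> _ [].
  move=> _ _; eexists; first reflexivity.
  (* As the machine is still running in [c], the number of steps left is positive. *)
  case: n halted E => [|n] halted E; first by move: halted; rewrite /= cr.
  rewrite iterSr in halted; apply: rewind_doomed => v' vv'.
  have -> : (dtm_action (dc_state c) D).1 = dc_state (dtm_step c).
    by rewrite (dtm_step_popped cv allD cr).
  apply: IH; [|reflexivity|exact: halted|].
    by rewrite -E /play_lt /play_measure; apply: Relation_Operators.left_slex.
  apply: (represents_move cv allD cr); first by rewrite vv' one.
  by move=> s; rewrite vv' gupd_game.
Qed.

(** * Loading the input *)

Let b_gt0 : 0 < b.
Proof. exact: leq_ltn_trans b_large. Qed.

Definition word_code (s : seq S) : nat :=
  foldr (fun a w => b * w + code (Some (inl a))) 0 s.

Lemma encodes_word (s : seq S) :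
  encodes (word_code s) (fun j => omap inl (onth s j)).
Proof.
elim: s => [|a s IH]; first by move=> j; rewrite /= div0n mod0n onth0n.
by apply: eq_encodes (encodes_push sym_code_lt (Some (inl a)) IH) => -[|j].
Qed.

Lemma word_code_lt s : word_code s < b ^ size s.
Proof.
elim: s => [|a s IH]; first by rewrite expn0.
have := sym_code_lt (Some (inl a)).
rewrite -[word_code (a :: s)]/(b * word_code s + code (Some (inl a))).
by move: (code _) => k kb; rewrite /= expnS; nia.
Qed.

Lemma word_code_rcons s a :
  word_code (rcons s a) = word_code s + code (Some (inl a)) * b ^ size s.
Proof.
elim: s => [|a' s IH]; first by rewrite /= expn0 muln0 muln1.
by rewrite rcons_cons /= IH expnS mulnDr mulnCA addnAC.
Qed.

Definition fresh v : Prop := [/\ v Msg1 = 0, v Msg2 = 0 & v Msg3 = 0].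

Definition loaded (s : seq S) v : Prop :=
  [/\ v One = 1, v Power = b ^ size s, v (Stack (ord0, true)) = word_code s,
      forall t, t != (ord0, true) -> v (Stack t) = 0 & fresh v].

Lemma loaded_represents v : loaded x v -> represents (dtm_init M x) (unpopped M) v.
Proof.
move=> [v1 _ vx v0 _]; split=> // -[i r]; rewrite ffunE.
have [[-> ->]|ir] := eqVneq (i, r) (ord0, true).
  rewrite vx; apply: eq_encodes (encodes_word x) => j.
  by rewrite /content /=.
rewrite v0 // => j; rewrite div0n mod0n /content /=.
case: r ir => [ir|_]; last first.
  have -> : (0 <= 0 - 1 - j%:Z)%R = false by lia.
  by rewrite andbF.
by have /negPf-> : i != ord0 by apply: contra ir => /eqP->.
Qed.

Lemma loaded_lt v t : loaded x v -> v (Stack t) < b ^ size x.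
Proof.
move=> [_ _ vx v0 _]; have [->|/v0->] := eqVneq t (ord0, true).
  by rewrite vx word_code_lt.
by rewrite expn_gt0 b_gt0.
Qed.

Lemma load_closed (Q : control M -> nat -> vect -> Prop) :
  step_closed (G := G) x Q ->
  (forall v, loaded x v ->
     Q (false, Some (dtm_start M, unpopped M, true, true)) 0 v) ->
  Q (false, None) 0 (@gvect0 S G).
Proof.
move=> clQ Qend.
have scan s2 s1 v : x = s1 ++ s2 -> loaded s1 v -> Q (false, None) (size s1).+1 v.
  elim: s2 s1 v => [|a s2 IH] s1 v xE lv.
    pose i := load_instr M b (@RightEnd S).
    apply: (clQ i _ _ _ (true, Some (dtm_start M, unpopped M, true, true))) => //.
      by move=> a; rewrite /ginstr xE cats0 input_at_right.
    apply: (rewind_closed _ clQ) => v' vv'; apply: Qend.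
    have kk : v' =1 v by move=> c; rewrite vv'; exact: gupd_keep.
    rewrite xE cats0; case: lv => l1 l2 l3 l4 [l5 l6 l7].
    split=> [|||t t0|]; rewrite ?kk //; first exact: l4.
    by split; rewrite kk.
  pose i := load_instr M b (Letter a).
  apply: (clQ i _ _ _ (false, None)) => //.
    by move=> a'; rewrite /ginstr xE input_at_letter.
  have -> : ghead (G := G) x i (size s1).+1 = (size (rcons s1 a)).+1.
    by rewrite /ghead /= xE size_cat size_rcons /=; lia.
  apply: IH; first by rewrite cat_rcons.
  case: lv => l1 l2 l3 l4 [l5 l6 l7]; split.
  - by rewrite gupd_one.
  - by rewrite gupd_game //= !fevalE l2 size_rcons expnS.
  - by rewrite gupd_game //= !fevalE l2 l3 word_code_rcons.
  - move=> t t0; rewrite gupd_game //=.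
    have /negPf-> : Stack t != Stack (ord0, true) by apply: contra t0 => /eqP[->].
    by rewrite /keep !fevalE l4.
  - by split; rewrite gupd_game //= /keep !fevalE.
pose i := load_instr M b (@LeftEnd S).
apply: (clQ i _ _ _ (false, None)) => //.
have -> : ghead (G := G) x i 0 = (size (Nil S)).+1 by rewrite /ghead /=; lia.
apply: (scan x) => //; split=> [||||].
- by rewrite gupd_one.
- by rewrite gupd_game //= /keep !fevalE.
- by rewrite gupd_game //= /keep !fevalE.
- by move=> t _; rewrite gupd_game //= /keep !fevalE.
- by split; rewrite gupd_game //= /keep !fevalE.
Qed.

Lemma dtm_game_doomed t :
  dtm_halt (dc_state (iter t (@dtm_step S M) (dtm_init M x))) = Some false ->
  doomed (g_start G) 0 (@gvect0 S G).
Proof.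
move=> halted; apply: load_closed => [|v lv]; first exact: step_closed_doomed.
apply: (@play_doomed t (dtm_init M x)); first exact: halted.
exact: loaded_represents.
Qed.

(** * Accepted inputs: a winning play *)

Lemma rewind_wins p h v : (forall v', v' =1 v -> wins (false, p) 0 v') ->
  wins (true, p) h v.
Proof. by apply: rewind_closed; exact: step_closed_wins. Qed.

Let digit m := Ordinal (ltn_pmod m b_gt0).

Lemma divn_lt_exp m k : m < b ^ k.+1 -> m %/ b < b ^ k.
Proof. by rewrite ltn_divLR // expnSr. Qed.

Lemma divn_digit m : b * (m %/ b) + digit m = m.
Proof. by rewrite mulnC -divn_eq. Qed.

(** Digits go most significant first: m %/ b is sent before the last digit of [m], and k digits take
    the head to cell [k]. *)
Lemma send1 q D f1 f2 k m v :
  k <= (size x).+1 -> m < b ^ k -> v One = 1 -> v Msg1 = 0 ->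
  (forall v', v' Msg1 = m -> (forall y, y != Msg1 -> v' y = v y) ->
     wins (false, Some (q, D, f1, f2)) k v') ->
  wins (false, Some (q, D, f1, f2)) 0 v.
Proof.
move=> + + v1 v0; elim: k m => [|k IH] m kx mk H.
  by apply: H => //; rewrite v0; case: m mk.
apply: (IH (m %/ b)) => [||v' v'm v'y]; [exact: ltnW|exact: divn_lt_exp|].
have nr := @input_at_not_right _ x k kx.
have iE : ginstr (G := G) x (false, Some (q, D, f1, f2)) (Digit1 M (digit m)) k =
    play_instr q D f1 f2 (Digit1 M (digit m)) (@LeftEnd S).
  by rewrite /ginstr /=; case: (input_at x k) nr => // -[].
apply: (wins_move (G := G) (a := Digit1 M (digit m))
  (q' := (false, Some (q, D, f1, f2)))); rewrite iE //.
have -> : ghead (G := G) x (play_instr q D f1 f2 (Digit1 M (digit m)) LeftEnd) k = k.+1.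
  exact: (minn_idPl kx).
apply: H => [|y y1].
  by rewrite gupd_game //= !fevalE v'm v'y // v1 muln1 divn_digit.
have [->|yn1] := eqVneq y One; first by rewrite gupd_one v'y.
by rewrite gupd_game //=; case: y y1 yn1 => // *; rewrite /keep !fevalE v'y.
Qed.

(** The k digits are preceded by the level 1 messages k - 1, ..., 0, the countdown that the tests
    demand; the first of them has to fit in n + 1 digits. *)
Lemma send2 q D f2 k m v :
  k <= b ^ (size x).+1 -> m < b ^ k -> v One = 1 -> v Msg1 = 0 -> v Msg2 = 0 ->
  (forall v' f1, v' Msg1 = 0 -> v' Msg2 = m ->
     (forall y, y \notin [:: Msg1; Msg2; Prev1] -> v' y = v y) ->
     wins (false, Some (q, D, f1, f2)) 0 v') ->
  wins (false, Some (q, D, true, f2)) 0 v.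
Proof.
move=> kb mk v1 v01 v02 H; pose K := k.
(* After j > 0 digits the last message of level 1 was k - j, and [f1] is still set only for j =
   0. *)
suff send j : j <= k -> forall m, m < b ^ j ->
    (forall v', v' Msg1 = 0 -> v' Msg2 = m -> (0 < j -> v' Prev1 = k - j) ->
       (forall y, y \notin [:: Msg1; Msg2; Prev1] -> v' y = v y) ->
       wins (false, Some (q, D, j == 0, f2)) 0 v') ->
    wins (false, Some (q, D, true, f2)) 0 v.
  by apply: (send k _ m) => // v' v'1 v'2 _ v'y; exact: H.
elim: j => [|j IH] jk m' m'j H'.
  by apply: H' => //; rewrite v02; case: m' m'j.
apply: (IH (ltnW jk) (m' %/ b)) => [|v' v'1 v'2 v'p v'y]; first exact: divn_lt_exp.
have v'one : v' One = 1 by rewrite v'y.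
(* Leading zeros pad the separating message to n + 1 digits. *)
apply: (@send1 _ _ _ _ (size x).+1 (k - j.+1)) => // [|v'' v''1 v''y].
  by apply: leq_trans kb; lia.
apply: (wins_move (G := G) (a := Digit2 M (digit m'))
  (q' := (true, Some (q, D, false, f2)))) => //.
  rewrite /passes /=; case: (posnP j) => [_|j0] //=.
  rewrite !fevalE v''1 !v''y // v'one v'p //; lia.
apply: rewind_wins => u uE; apply: H' => [||_|y yn].
- by rewrite uE gupd_game //= fevalE.
- by rewrite uE gupd_game //= !fevalE !v''y // v'2 v'one muln1 divn_digit.
- by rewrite uE gupd_game //= /keep !fevalE.
- have [->|yn1] := eqVneq y One; first by rewrite uE gupd_one v''y // v'y.
  rewrite uE gupd_game //=; move: yn; rewrite !inE !negb_or => /and3P[y1 y2 y3].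
  rewrite -v'y ?inE ?negb_or ?y1 ?y2 // -v''y //.
  by case: y yn1 y1 y2 y3 => // *; rewrite /keep !fevalE.
Qed.

(** The same countdown one level up: the messages k - 1, ..., 0 of level 2 are each sent with b ^ (n
    + 1) digits. *)
Lemma send3 q D k m v :
  k <= b ^ (b ^ (size x).+1) -> m < b ^ k -> v One = 1 -> fresh v ->
  (forall v' f1 f2, v' Msg1 = 0 -> v' Msg2 = 0 -> v' Msg3 = m ->
     v' One = 1 -> (forall s, v' (Stack s) = v (Stack s)) ->
     wins (false, Some (q, D, f1, f2)) 0 v') ->
  wins (false, Some (q, D, true, true)) 0 v.
Proof.
move=> kb mk v1 [v01 v02 v03] H.
suff send j : j <= k -> forall m, m < b ^ j ->
    (forall v', v' Msg1 = 0 -> v' Msg2 = 0 -> v' Msg3 = m ->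
       (0 < j -> v' Prev2 = k - j) -> v' One = 1 ->
       (forall s, v' (Stack s) = v (Stack s)) ->
       wins (false, Some (q, D, true, j == 0)) 0 v') ->
    wins (false, Some (q, D, true, true)) 0 v.
  by apply: (send k _ m) => // v' v'1 v'2 v'3 _ *; exact: H.
elim: j => [|j IH] jk m' m'j H'.
  by apply: H' => //; rewrite v03; case: m' m'j.
apply: (IH (ltnW jk) (m' %/ b)) => [|v' v'1 v'2 v'3 v'p v'one v's];
  first exact: divn_lt_exp.
apply: (@send2 _ _ _ (b ^ (size x).+1) (k - j.+1)) => // [|v'' f1 v''1 v''2 v''y].
  by apply: leq_trans kb; lia.
apply: (wins_move (G := G) (a := Digit3 M (digit m'))
  (q' := (true, Some (q, D, true, false)))) => //.
  rewrite /passes /=; case: (posnP j) => [_|j0] //=.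
  rewrite !fevalE v''2 !v''y // v'one v'p //; lia.
apply: rewind_wins => u uE; apply: H' => [|||_||s].
- by rewrite uE gupd_game //= fevalE.
- by rewrite uE gupd_game //= fevalE.
- by rewrite uE gupd_game //= !fevalE !v''y // v'3 v'one muln1 divn_digit.
- by rewrite uE gupd_game //= /keep !fevalE.
- by rewrite uE gupd_one v''y.
- by rewrite uE gupd_game //= /keep !fevalE v''y.
Qed.

Lemma pop_wins c D v e :
  represents c D v -> fresh v -> (forall s, v (Stack s) < b ^ e) ->
  e <= b ^ (b ^ (size x).+1) ->
  (forall D' v', all_popped D' -> represents c D' v' -> fresh v' ->
     (forall s, v' (Stack s) < b ^ e) ->
     wins (false, Some (dc_state c, D', true, true)) 0 v') ->
  wins (false, Some (dc_state c, D, true, true)) 0 v.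
Proof.
move=> + + + eb H; have [r] := ubnP (rest D); elim: r D v => // r IH D v Dr cv fv ve.
have [allD|] := boolP (all_popped D); first exact: H.
rewrite negb_forall => /existsP[s]; rewrite negbK => /eqP Ds.
apply: (@send3 _ _ e (v (Stack s) %/ b)) => //.
- by apply: leq_ltn_trans (ve s); exact: leq_div.
- exact: cv.1.
move=> v' f1 f2 v'1 v'2 v'3 v'one v's.
have vs : v (Stack s) = b * (v (Stack s) %/ b) + code (content c s 0).
  by apply: encodes_head; have := cv.2 s; rewrite Ds.
pose D' := [ffun s' => if s' == s then Some (content c s 0) else D s'].
apply: (wins_move (G := G) (a := Pop b s (content c s 0))
  (q' := (true, Some (dc_state c, D', true, true)))).
- by rewrite /ginstr /= Ds /passes /= !fevalE v's v'3 v'one muln1.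
- by rewrite /ginstr /= Ds.
rewrite /ginstr /= Ds; apply: rewind_wins => u uE.
have us : u (Stack s) = v (Stack s) %/ b.
  by rewrite uE gupd_game //= eqxx /keep !fevalE.
have us' s' : s' != s -> u (Stack s') = v (Stack s').
  move=> ss'; rewrite uE gupd_game //=.
  have /negPf-> : Stack s' != Stack s by apply: contra ss' => /eqP[->].
  by rewrite /keep !fevalE.
apply: IH.
- by rewrite -ltnS; apply: leq_trans Dr; rewrite ltnS; exact: rest_pop.
- apply: (represents_pop cv Ds vs) => //.
  by rewrite uE gupd_one v'one cv.1.
- by split; rewrite uE gupd_game //= fevalE.
- move=> s'; have [->|/us'->] := eqVneq s' s; last exact: ve.
  by rewrite us; apply: leq_ltn_trans (ve s); exact: leq_div.
Qed.

Lemma move_stack_lt c D v e s : represents c D v ->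
  (forall s, v (Stack s) < b ^ e) ->
  feval (move_stack b (dc_state c) D s) v < b ^ e.+2.
Proof.
move=> cv ve; have vs := ve s; rewrite /move_stack !expnS.
case: (dtm_action _ _).2 => g m.
have := sym_code_lt g.
have := sym_code_lt (popped D (s.1, false)).
have push y k B : k < b -> y < B -> b * y + k < b * B by nia.
have weaken B : B <= b * B by rewrite leq_pmull.
move: (code g) (code _) => k l lb kb.
case: m; case: s.2; rewrite !fevalE ?cv.1 ?muln1 ?(addnA _ (b * _)) -?mulnA -?mulnDr.
- by apply: (push) => //; exact: push.
- by do 2!apply: leq_trans (weaken _).
- by apply: leq_trans (weaken _); exact: push.
- by apply: leq_trans (weaken _); exact: push.
- by do 2!apply: leq_trans (weaken _).
- by apply: (push) => //; exact: push.
Qed.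

(** A transition adds at most two digits to the bound on the stacks, so e + 2t digits suffice
    throughout the run, and that many digits can be sent at level 3. *)
Lemma run_wins t c v e :
  dtm_halt (dc_state (iter t (@dtm_step S M) c)) = Some true ->
  represents c (unpopped M) v -> fresh v -> (forall s, v (Stack s) < b ^ e) ->
  e + t.*2 <= b ^ (b ^ (size x).+1) ->
  wins (false, Some (dc_state c, unpopped M, true, true)) 0 v.
Proof.
elim: t c v e => [|t IH] c v e halted cv fv ve et;
  (apply: (pop_wins cv fv ve) => [|D u allD cu fu ue]; first by lia).
  apply: (ex_intro _ [:: Transition M b]); apply: winning_last;
    by rewrite /ginstr /= allD /= (halted : dtm_halt (dc_state c) = _).
case cr: (dtm_halt (dc_state c)) => [[]|].
- apply: (ex_intro _ [:: Transition M b]); apply: winning_last;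
    by rewrite /ginstr /= allD /= cr.
- by move: halted; rewrite (iter_halted t.+1 cr) cr.
apply: (wins_move (G := G) (a := Transition M b)
  (q' := (true, Some (dc_state (dtm_step c), unpopped M, true, true)))).
- by rewrite /ginstr /= allD /= cr.
- by rewrite /ginstr /= allD /= cr (dtm_step_popped cu allD cr).
rewrite /ginstr /= allD /= cr; apply: rewind_wins => w wE.
have ws s : w (Stack s) = feval (move_stack b (dc_state c) D s) u.
  by rewrite wE gupd_game.
apply: (IH _ _ e.+2).
- by rewrite -iterSr.
- by apply: (represents_move cu allD cr _ ws); rewrite wE gupd_one.
- by split; rewrite wE gupd_game //= fevalE.
- by move=> s; rewrite ws; exact: move_stack_lt.
- lia.
Qed.

Lemma dtm_game_wins t :
  dtm_halt (dc_state (iter t (@dtm_step S M) (dtm_init M x))) = Some true ->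
  size x + t.*2 <= b ^ (b ^ (size x).+1) ->
  exists l, winning x l (g_start G) 0 (@gvect0 S G).
Proof.
move=> halted xt; apply: (load_closed (Q := wins)) => [|v lv].
  exact: step_closed_wins.
apply: (run_wins (e := size x) halted (loaded_represents lv)) => // [|s].
  by case: lv.
exact: loaded_lt.
Qed.

End DtmGameFacts.

(** * Exponential time *)

(** Since n^k <= (2^n)^k = (2^k)^n, a constant base b above c1 and at least 2^k keeps n + c1 n^k
    below b^(n+1); one further factor b absorbs the constant of the time bound. *)
Lemma exptime_bound (f g : nat -> nat) k :
  bigO g (fun n => n ^ k) -> bigO f (fun n => 2 ^ g n) ->
  exists b0, forall b n, b0 <= b -> n + (f n).*2 <= b ^ (b ^ n.+1).
Proof.
move=> [c1 [N1 gb]] [c2 [N2 fb]]; pose N := maxn N1 N2.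
(* The sum covers the finitely many lengths below the thresholds. *)
pose C := \sum_(i < N) f i + c2.
have fC n : f n <= C * 2 ^ (c1 * n ^ k).
  have [nN|Nn] := ltnP n N.
    have fK : f n <= \sum_(i < N) f i by rewrite (bigD1 (Ordinal nN)) //= leq_addr.
    apply: leq_trans fK _; apply: leq_trans (leq_addr c2 _) _.
    by rewrite leq_pmulr // expn_gt0.
  move: Nn; rewrite geq_max => /andP[n1 n2]; apply: leq_trans (fb n n2) _.
  by rewrite leq_mul ?leq_addl // leq_exp2l // gb.
exists (C.*2 + c1 + 2 ^ k + 2) => b n b0b.
have [b2 bC bc bk] : [/\ 2 <= b, C.*2.+1 <= b, c1.+1 <= b & 2 ^ k <= b].
  by split; lia.
have n2 : n < 2 ^ n by exact: ltn_expl.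
have expo : n + c1 * n ^ k < b ^ n.+1.
  have nk : n ^ k <= b ^ n.
    apply: (@leq_trans ((2 ^ k) ^ n)); last by case: (n) => // m; rewrite leq_exp2r.
    rewrite -expnM mulnC expnM; case: (k) => // j.
    by rewrite leq_exp2r // ltnW.
  have n2b : n < b ^ n.
    by apply: leq_trans n2 _; case: (n) => // m; rewrite leq_exp2r.
  rewrite expnS; apply: (@leq_trans (c1.+1 * b ^ n)); last by rewrite leq_mul2r bc orbT.
  by rewrite mulSn -addSn leq_add // leq_mul2l nk orbT.
apply: (@leq_trans (b ^ (n + c1 * n ^ k).+1)); last by rewrite leq_exp2l.
have P0 : 0 < 2 ^ (c1 * n ^ k) by rewrite expn_gt0.
apply: (@leq_trans (b * 2 ^ (n + c1 * n ^ k))).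
  rewrite expnD; have := fC n; move: (2 ^ (c1 * n ^ k)) (2 ^ n) P0 n2 => p q p0 nq fp.
  apply: (@leq_trans (C.*2.+1 * (q * p))); last by rewrite leq_mul2r bC orbT.
  rewrite mulSn leq_add //; first by apply: leq_trans (ltnW nq) _; rewrite leq_pmulr.
  rewrite -doubleMl leq_double; apply: leq_trans fp _.
  by rewrite leq_mul2l leq_pmull ?orbT //; case: (q) nq.
by rewrite expnS leq_mul //; case: (n + _) => // m; rewrite leq_exp2r.
Qed.

Theorem corollary2 (R : realType) (S : finType) (L : language S) :
  EXPTIME L -> qAM1 R log2n L.
Proof.
move=> [k _ [g gO [M [f [fO Mdec]]]]].
have [b0 b0P] := exptime_bound gO fO.
(* The base reaches the threshold of the time bound and exceeds every letter code, so that codes are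
   digits. *)
pose b := b0 + #|{: S + dtm_aux M}|.+1.
have b_large : #|{: S + dtm_aux M}| < b by exact: leq_addl.
apply: (@game_qAM1 R S (dtm_game M b)) => x Lx.
  have [t tf [[halted _]|[_ nLx]]] := Mdec x; last by case: nLx.
  apply: (dtm_game_wins b_large halted).
  apply: leq_trans (b0P b (size x) (leq_addr _ _)).
  by rewrite leq_add2l leq_double.
have [t tf [[_ nLx]|[halted _]]] := Mdec x; first by case: Lx.
exact: (dtm_game_doomed b_large halted).
Qed.
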